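(* Let $(G,K)=(\mathrm{SO}_{2n}(\mathbb C),\mathrm{GL}_n(\mathbb C))$ (symmetric pair of type DIII), and let $P=P_S\subset G$, $Q=Q_T\subset K$ be parabolic subgroups with $S\subset\{\alpha_1,\dots,\alpha_n\}$, $T\subset\{\beta_1,\dots,\beta_{n-1}\}$ in the notation of the context. The double flag variety $K/Q\times G/P$ has finitely many $K$-orbits (for the diagonal action) in each of the following cases: (a) $S=\{\alpha_1\}$, $\{\alpha_{n-1}\}$ or $\{\alpha_n\}$, and $T$ is any subset; (b) $S=\{\alpha_i\}$ and $T=\{\beta_j\}$, for any $i,j$.
   Context: $\mathrm{GL}_n$ is embedded in $\mathrm{SO}_{2n}$ as the subgroup stabilizing both summands of a decomposition $\mathbb C^{2n}=V^+\oplus V^-$ of the quadratic space into Lagrangian ($n$-dimensional isotropic) subspaces. For $i\le n-2$, $P_{\{\alpha_i\}}$ is the stabilizer of an isotropic subspace of dimension $i$; $P_{\{\alpha_{n-1}\}}$ and $P_{\{\alpha_n\}}$ are the stabilizers of Lagrangian subspaces of the two families (standard numbering of $D_n$; $S=\Pi\setminus J$ is the complement of the set of simple roots generating the Levi part). For $T=\{\beta_{j_1},\dots,\beta_{j_l}\}$, $Q_T\subset\mathrm{GL}_n$ is the stabilizer of a flag of subspaces of $\mathbb C^n$ of dimensions $j_1<\dots<j_l$. *)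

(* Defs.v *)
From HB Require Import structures.
From mathcomp Require Import all_boot all_order all_algebra.
From mathcomp Require Import classical_sets cardinality reals.
From mathcomp.real_closed Require Import complex.

Set Implicit Arguments.
Unset Strict Implicit.
Unset Printing Implicit Defensive.

Import Order.TTheory GRing.Theory Num.Theory.

Local Open Scope classical_set_scope.
Local Open Scope ring_scope.

(* Vectors are row vectors, matrices act on them on the right, and a subspace *)
(* is the row space of a square matrix (order and rank as in mxalgebra).      *)

Section CosetSpaces.
Context {F : fieldType} {m : nat}.
Implicit Types (G H K P Q : set 'M[F]_m).

Definition ltranslate (g : 'M[F]_m) (A : set 'M[F]_m) : set 'M[F]_m :=
  [set g *m h | h in A].

(* G/H, the set of the left cosets gH *)
Definition coset_space G H : set (set 'M[F]_m) :=
  [set ltranslate g H | g in G].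

Definition double_flag K Q G P : set (set 'M[F]_m * set 'M[F]_m) :=
  coset_space K Q `*` coset_space G P.

Definition diag_act (k : 'M[F]_m) (x : set 'M[F]_m * set 'M[F]_m) :=
  (ltranslate k x.1, ltranslate k x.2).

Definition diag_orbit K (x : set 'M[F]_m * set 'M[F]_m) :=
  [set diag_act k x | k in K].

Definition finitely_many_orbits K Q G P : Prop :=
  finite_set [set diag_orbit K x | x in double_flag K Q G P].

(* The subgroup of H stabilizing U i for all i in I. As H consists of         *)
(* invertible matrices, U i *m g <= U i amounts to equality of subspaces.     *)
Definition stabilizer (H : set 'M[F]_m) (I : set nat) (U : nat -> 'M[F]_m) :
    set 'M[F]_m :=
  [set g | H g /\ forall i, I i -> stablemx (U i) g].

End CosetSpaces.

Section QuadraticSpace.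
Context {F : fieldType} {n : nat}.
(* B is the Gram matrix of the symmetric bilinear form u, v |-> u B v^T.      *)
Implicit Types (B U V Vp Vm g : 'M[F]_(2 * n)).

Definition special_orthogonal B : set 'M[F]_(2 * n) :=
  [set g | g *m B *m g^T = B /\ \det g = 1].

Definition isotropic B U : Prop := U *m B *m U^T = 0.

Definition lagrangian B U : Prop := isotropic B U /\ \rank U = n.

Definition lagrangian_decomposition B Vp Vm : Prop :=
  [/\ lagrangian B Vp, lagrangian B Vm,
      (Vp + Vm :=: 1%:M)%MS & (Vp :&: Vm :=: (0 : 'M[F]_(2 * n)))%MS].

(* GL_n inside SO_2n *)
Definition levi_GL B Vp Vm : set 'M[F]_(2 * n) :=
  [set g | [/\ special_orthogonal B g, stablemx Vp g & stablemx Vm g]].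

(* The two families of Lagrangian subspaces are the two orbits of SO_2n.      *)
Definition same_family B U V : Prop :=
  exists2 g, special_orthogonal B g & (V :=: U *m g)%MS.

(* Isotropic flags U whose stabilizers in SO_2n are the parabolic subgroups   *)
(* P_S, where S is a subset of {1, ..., n}; only the U i with i in S matter.  *)
(* The member attached to alpha_i has dimension i for i <= n - 2; those       *)
(* attached to alpha_n and alpha_(n-1) are Lagrangian, respectively in the    *)
(* family of Vp and in the other one. If both occur, they are incident, i.e.  *)
(* they meet in dimension n - 1.                                              *)
Definition isotropic_flag B Vp (S : set nat) (U : nat -> 'M[F]_(2 * n)) : Prop :=
  [/\ forall i, S i -> (i + 2 <= n)%N -> isotropic B (U i) /\ \rank (U i) = i,
      forall i k, S i -> S k -> (i + 2 <= n)%N -> (i < k)%N -> (U i <= U k)%MS,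
      S n.-1 -> lagrangian B (U n.-1) /\ ~ same_family B Vp (U n.-1),
      S n -> lagrangian B (U n) /\ same_family B Vp (U n)
    & S n.-1 -> S n -> \rank (U n.-1 :&: U n)%MS = n.-1].

(* Flags of C^n with dimensions in T, where C^n, the defining representation  *)
(* of GL_n, is identified with Vp.                                            *)
Definition linear_flag Vp (T : set nat) (W : nat -> 'M[F]_(2 * n)) : Prop :=
  (forall j, T j -> (W j <= Vp)%MS /\ \rank (W j) = j) /\
  (forall j k, T j -> T k -> (j < k)%N -> (W j <= W k)%MS).

End QuadraticSpace.

(* Main.v *)
Require Import Defs.
From mathcomp Require Import all_boot all_order all_algebra.
From mathcomp Require Import boolp classical_sets cardinality reals.
From mathcomp.real_closed Require Import complex.

(** Put X = Vp. The form B identifies Vm with the dual X^* of X, and K with GL(X)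
acting on X + X^*. In a basis of X and the dual basis of X^*, an isotropic
subspace U of X + X^* is the row space of a block matrix (P | Q) for which P Q^T
is skew-symmetric; here vP and vQ are the components in X and X^* of the vector
of U with parameter v. A double flag is such a U together with subspaces W_i of X.

Finiteness follows from a normal form that need not be unique: every double flag
under consideration has an adapted basis of X, in which U and all the W_i are
spanned by vectors with coordinates 0, 1 and -1 ([standardizable]). The
coordinates take finitely many values, and two double flags with the same
coordinates are exchanged by the element of GL(X) that maps one adapted basis to
the other ([finitely_many_orbits_standardizable]).

Adapted bases are built by induction on dim X. If a direct sum X = X1 + X2,
together with the dual one for X^*, splits U and all the W_i, and if X1 has a
basis in which its own part of the configuration has coordinates 0, 1 and -1, then
only X2 is left to treat ([split_off], [split_coord]). A splitting is given by a
basis of X1 together with a dual family of functionals, whose common kernel is X2.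
So most of the proof consists in finding a small summand X1, of dimension 1, 2
or 4.

The W_i of a flag form a chain, and a chain interacts well with a single vector
or functional ([chain_functional], [chain_vector]). Hence any line in the
intersection of U with X or with X^* gives a summand of dimension 1
([reducible_left], [reducible_right]). If U is a line spanned by a + phi with a
and phi nonzero, there is a summand of dimension 2 containing a
([standardizable_line]). If U is Lagrangian and meets X and X^* trivially, it is
the graph of a symplectic form on X, and a hyperbolic plane compatible with the
flag splits off ([standardizable_lagrangian]).

If U is any isotropic subspace and there is a single W ([standardizable_subspace]),
let A be the projection of U to X. When U meets X and X^* trivially, every vector
of A is the X component of exactly one vector of U, whose X^* component is its
partner functional; in particular A carries the skew form P Q^T. Suppose that
this form is degenerate, and let m be a nonzero vector of its radical, taken in W
if possible. Then m lies in a summand of dimension 2, unless m is not in W and its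
partner is nonzero on W and agrees there with the partner of a vector of A in W;
in this case the two vectors lie in a common summand of dimension 4
([reducible_radical]). If the form is nondegenerate, X is the direct sum of A and
of the annihilator C of the X^* components of U; after splitting off lines of C,
the subspace W is the graph of a map onto C from a subspace S1 of A, whose kernel
is the intersection S0 of W with A. The Lagrangian case, applied to A with the
flag S0 in S1, provides a basis of A which extends to an adapted basis of X
([standardizable_symplectic]). *)

Set Implicit Arguments.
Unset Strict Implicit.
Unset Printing Implicit Defensive.

Import Order.TTheory GRing.Theory Num.Theory.
Local Open Scope ring_scope.

(** * Linear algebra *)

Section Tools.
Context {F : fieldType}.

Definition sign_mx p q (A : 'M[F]_(p, q)) : Prop :=
  forall i j, A i j \in [:: 0; 1; -1].

Lemma sign_mx_block p1 p2 q1 q2 (A : 'M[F]_(p1, q1)) (D : 'M[F]_(p2, q2)) :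
  sign_mx A -> sign_mx D -> sign_mx (block_mx A 0 0 D).
Proof.
move=> sA sD i j; case: (split_ordP i) => i' ->; case: (split_ordP j) => j' ->.
- by rewrite block_mxEul.
- by rewrite block_mxEur mxE !inE eqxx.
- by rewrite block_mxEdl mxE !inE eqxx.
- by rewrite block_mxEdr.
Qed.

Lemma sign_mx0 p q : sign_mx (0 : 'M[F]_(p, q)).
Proof. by move=> i j; rewrite mxE !inE eqxx. Qed.

Lemma sign_mx1 p : sign_mx (1%:M : 'M[F]_p).
Proof. by move=> i j; rewrite mxE; case: eqP; rewrite !inE eqxx ?orbT. Qed.

Lemma sub_row_mxP k k' p q (A : 'M[F]_(k, p)) (B : 'M[F]_(k, q))
    (A' : 'M[F]_(k', p)) (B' : 'M[F]_(k', q)) :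
  reflect (exists D, A = D *m A' /\ B = D *m B')
          (row_mx A B <= row_mx A' B')%MS.
Proof.
apply: (iffP submxP) => -[D].
  by rewrite mul_mx_row => /eq_row_mx[]; exists D.
by case=> -> ->; exists D; rewrite mul_mx_row.
Qed.

(** A linear system is solvable as soon as its right-hand side satisfies the
linear relations between the left-hand sides. *)
Lemma solve_right m n p (M : 'M[F]_(m, n)) (c : 'M[F]_(m, p)) :
  (forall v : 'rV_m, v *m M = 0 -> v *m c = 0) -> exists x, M *m x = c.
Proof.
move=> ker_c.
have : (c^T <= M^T)%MS.
  rewrite submxE -trmx_eq0 trmx_mul trmxK; apply/eqP/row_matrixP => i.
  rewrite row_mul row0; apply: ker_c; rewrite -row_mul.
  by rewrite -[M in _ *m M]trmxK -trmx_mul mulmx_coker trmx0 row0.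
by case/submxP => D cD; exists D^T; rewrite -[M]trmxK -trmx_mul -cD trmxK.
Qed.
Lemma functional_off m n (e : 'rV[F]_n) (V : 'M[F]_(m, n)) :
  ~~ (e <= V)%MS -> exists2 psi : 'rV[F]_n, e *m psi^T = 1%:M & V *m psi^T = 0.
Proof.
move=> eV.
have [v|x] := @solve_right _ _ 1 (col_mx e V) (col_mx 1%:M 0).
  rewrite -[v]hsubmxK !mul_row_col mulmx0 addr0 mulmx1 => eq0.
  apply: contraNeq eV => nz; have [c def_c] : exists c, lsubmx v = c%:M.
    by exists (lsubmx v 0 0); apply: mx11_scalar.
  move: nz eq0; rewrite def_c => nz /eqP; rewrite addr_eq0 mul_scalar_mx => /eqP ce.
  have cn0 : c != 0 by apply: contraNneq nz => ->; rewrite raddf0.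
  by rewrite -(scalerK cn0 e) ce scalemx_sub // eqmx_opp submxMl.
rewrite mul_col_mx => /eq_col_mx[ex Vx].
by exists x^T; rewrite trmxK.
Qed.

Lemma dual_vector m n (V : 'M[F]_(m, n)) (phi : 'rV[F]_n) :
  V *m phi^T != 0 -> exists2 x : 'rV_n, (x <= V)%MS & x *m phi^T = 1%:M.
Proof.
move=> nz; have [i nzi] : exists i, row i (V *m phi^T) != 0.
  apply/existsP; apply: contraNT nz => /existsPn z; apply/eqP/row_matrixP => i.
  by rewrite row0; apply/eqP/negbNE/z.
set c := (row i (V *m phi^T)) 0 0.
have def_c : row i (V *m phi^T) = c%:M by apply: mx11_scalar.
have cn0 : c != 0 by apply: contraNneq nzi => c0; rewrite def_c c0 raddf0.
exists (c^-1 *: row i V); first by rewrite scalemx_sub ?row_sub.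
by rewrite -scalemxAl -row_mul def_c scale_scalar_mx mulVf.
Qed.

(** The members of a flag, listed in any order and possibly with repetitions. *)
Definition chain (I : finType) l n (W : I -> 'M[F]_(l, n)) : Prop :=
  forall i j, (W i <= W j)%MS || (W j <= W i)%MS.

Section Chain.
Context {I : finType} {l n : nat} {W : I -> 'M[F]_(l, n)}.
Context (chW : chain W).

Lemma chain_max (pr : pred I) :
  (exists2 i, pr i & forall j, pr j -> (W j <= W i)%MS) \/ forall j, ~~ pr j.
Proof.
case: (pickP pr) => [i0 pr_i0 | none]; last by right=> j; rewrite none.
left; case: (arg_maxnP (fun i => \rank (W i)) pr_i0) => i pr_i max_i.
exists i => // j /max_i rk; case/orP: (chW i j) => // sub_ij.
by rewrite -(mxrank_leqif_sup sub_ij).2 eqn_leq (mxrankS sub_ij).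
Qed.

Lemma chain_min (pr : pred I) :
  (exists2 i, pr i & forall j, pr j -> (W i <= W j)%MS) \/ forall j, ~~ pr j.
Proof.
case: (pickP pr) => [i0 pr_i0 | none]; last by right=> j; rewrite none.
left; case: (arg_minnP (fun i => \rank (W i)) pr_i0) => i pr_i min_i.
exists i => // j /min_i rk; case/orP: (chW j i) => // sub_ji.
by rewrite -(mxrank_leqif_sup sub_ji).2 eqn_leq (mxrankS sub_ji).
Qed.

(** The hyperplane psi = 0 contains the largest member of the chain that does not
contain e; so e and this hyperplane split every member of the chain. *)
Lemma chain_functional (e : 'rV[F]_n) : e != 0 ->
  exists2 psi : 'rV[F]_n, e *m psi^T = 1%:M &
    forall i, (e <= W i)%MS \/ W i *m psi^T = 0.
Proof.
move=> nze; case: (chain_max (fun i => ~~ (e <= W i)%MS)) => [[i ei max_i]|all_e].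
  have [psi e1 W0] := functional_off ei; exists psi => // j.
  case: (boolP (e <= W j)%MS) => [|ej]; [by left | right].
  by case/submxP: (max_i j ej) => D ->; rewrite -mulmxA W0 mulmx0.
have [|psi e1 _] := @functional_off n n e 0; first by rewrite submx0.
by exists psi => // i; left; apply/negbNE/all_e.
Qed.

(** Dually, x is taken in the smallest member of the chain on which phi does not
vanish; so x and the kernel of phi split every member of the chain. *)
Lemma chain_vector (phi : 'rV[F]_n) : phi != 0 ->
  exists2 x : 'rV[F]_n, x *m phi^T = 1%:M &
    forall i, (x <= W i)%MS \/ W i *m phi^T = 0.
Proof.
move=> nzp; case: (chain_min (fun i => W i *m phi^T != 0)) => [[i pi min_i]|all0].
  have [x xW x1] := dual_vector pi; exists x => // j.
  case: (eqVneq (W j *m phi^T) 0) => [|pj]; [by right | left].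
  exact: submx_trans xW (min_i j pj).
have [|x _ x1] := @dual_vector n n 1%:M phi; first by rewrite mul1mx trmx_eq0.
by exists x => // i; right; apply/eqP/negbNE/all0.
Qed.

Lemma chain_first : (0 < n)%N ->
  exists2 e : 'rV[F]_n, e != 0 & forall i, (e <= W i)%MS \/ W i = 0.
Proof.
move=> n_gt0; case: (chain_min (fun i => W i != 0)) => [[i Wi min_i]|all0].
  have [e eW nze] := rowV0Pn Wi; exists e => // j.
  case: (eqVneq (W j) 0) => [|Wj]; [by right | left].
  exact: submx_trans eW (min_i j Wj).
exists (delta_mx 0 (Ordinal n_gt0)) => [|i].
  by apply/negP => /eqP/rowP/(_ (Ordinal n_gt0))/eqP; rewrite !mxE !eqxx oner_eq0.
by right; apply/eqP/negbNE/all0.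
Qed.
End Chain.

End Tools.

(** * Adapted bases and splittings *)

Section Standard.
Context {F : fieldType}.

(** The rows of G form the adapted basis and those of H the dual basis. The size n'
of the basis is kept apart from the equal number n, so that bases of two
summands can be stacked without casts. When coord holds, each W_i has to be
spanned by a part of the basis. *)
Definition standardizable (coord : bool) k l n (I : finType)
    (P Q : 'M[F]_(k, n)) (W : I -> 'M[F]_(l, n)) : Prop :=
  exists n' (G H : 'M[F]_(n', n)) h (a b : 'M[F]_(h, n')) (w : I -> 'M[F]_n'),
    [/\ G *m H^T = 1%:M /\ H^T *m G = 1%:M,
        sign_mx a /\ sign_mx b,
        (row_mx P Q :=: row_mx (a *m G) (b *m H))%MS &
        forall i, [/\ sign_mx (w i), coord ==> is_diag_mx (w i)
                    & (W i :=: w i *m G)%MS]].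

Lemma standardizable_eqmx coord k k' l l' n (I : finType)
    (P Q : 'M[F]_(k, n)) (P' Q' : 'M[F]_(k', n))
    (W : I -> 'M[F]_(l, n)) (W' : I -> 'M[F]_(l', n)) :
    (row_mx P' Q' :=: row_mx P Q)%MS -> (forall i, W' i :=: W i)%MS ->
  standardizable coord P Q W -> standardizable coord P' Q' W'.
Proof.
move=> eqU eqW [n' [G [H [h [a [b [w [GH ab Uab Ww]]]]]]]].
exists n', G, H, h, a, b, w; split=> // [|i]; first exact: eqmx_trans eqU Uab.
by have [? ? Wi] := Ww i; split=> //; apply: eqmx_trans (eqW i) Wi.
Qed.

(** The row space of (P | Q) is isotropic for the duality pairing of X and X^*. *)
Definition isotropic_pair k n (P Q : 'M[F]_(k, n)) : Prop :=
  P *m Q^T + Q *m P^T = 0.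

(** The rows of X are a basis of the summand that remains to be treated, and those of
Y its dual basis; so P Y^T, Q X^T and W_i Y^T are the coordinates of the
configuration induced on this summand. *)
Definition reducible coord k l n (I : finType) (P Q : 'M[F]_(k, n))
    (W : I -> 'M[F]_(l, n)) : Prop :=
  exists r (X Y : 'M[F]_(r, n)),
    [/\ (r < n)%N, X *m Y^T = 1%:M, isotropic_pair (P *m Y^T) (Q *m X^T) &
      standardizable coord (P *m Y^T) (Q *m X^T) (fun i => W i *m Y^T) ->
      standardizable coord P Q W].

(** The summand spanned by the rows of X has dual basis Y, and its complement is the
common kernel of the rows of Y. The rows of u are the parameters of vectors of U
that span the part of U in the first summand, with coordinates a and b; the
equations on s say that the projection of U to the first summand stays in U. The
same is required of the W_i, with coordinates w. *)
Lemma split_off coord k l n n1 k1 (I : finType)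
    (P Q : 'M[F]_(k, n)) (W : I -> 'M[F]_(l, n)) (X Y : 'M[F]_(n1, n))
    (a b : 'M[F]_(k1, n1)) (u : 'M[F]_(k1, k)) (s : 'M[F]_(k, k1))
    (w : I -> 'M[F]_n1) :
    (0 < n1)%N -> isotropic_pair P Q ->
    X *m Y^T = 1%:M -> sign_mx a -> sign_mx b ->
    u *m P = a *m X -> u *m Q = b *m Y ->
    P *m Y^T = s *m a -> Q *m X^T = s *m b ->
    (forall i, [/\ sign_mx (w i), coord ==> is_diag_mx (w i),
                   (w i *m X <= W i)%MS & (W i *m Y^T <= w i)%MS]) ->
  reducible coord P Q W.
Proof.
move=> n1_gt0 PQ XY sa sb uP uQ PY QX wP.
pose N := 1%:M - Y^T *m X; pose r := \rank N.
pose X2 : 'M_(r, n) := row_base N; pose Y2 : 'M_(r, n) := (col_base N)^T.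
have YX2 : Y2^T *m X2 = N by rewrite trmxK mulmx_base.
have NN : N *m N = N.
  by rewrite {2}/N mulmxBr mulmx1 /N mulmxBl mul1mx -mulmxA (mulmxA X) XY mul1mx subrr subr0.
have X2Y : X2 *m Y2^T = 1%:M.
  have /row_freeP[R XR] : row_free X2 by apply: row_base_free.
  have /row_fullP[L LY] : row_full Y2^T by rewrite trmxK col_base_full.
  have -> : X2 *m Y2^T = L *m ((Y2^T *m X2) *m (Y2^T *m X2)) *m R.
    by rewrite -[LHS]mul1mx -LY -[LHS]mulmx1 -XR !mulmxA.
  by rewrite YX2 NN -YX2 mulmxA LY mul1mx XR.
clearbody X2 Y2.
have XN : X *m N = 0 by rewrite mulmxBr mulmx1 mulmxA XY mul1mx subrr.
have NY : N *m Y^T = 0 by rewrite mulmxBl mul1mx -mulmxA XY mulmx1 subrr.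
have XY2 : X *m Y2^T = 0.
  by rewrite -[LHS]mulmx1 -X2Y mulmxA -(mulmxA X) YX2 XN mul0mx.
have X2Y1 : X2 *m Y^T = 0.
  by rewrite -[LHS]mul1mx -X2Y mulmxA -(mulmxA X2) YX2 -mulmxA NY mulmx0.
have GH : col_mx X X2 *m (col_mx Y Y2)^T = 1%:M.
  by rewrite tr_col_mx mul_col_row XY XY2 X2Y1 X2Y scalar_mx_block.
exists r, X2, Y2; split=> //.
- by apply: leq_trans (mulmx1_min GH); rewrite -[X in (X < _)%N]add0n ltn_add2r.
- have ab0 : a *m b^T + b *m a^T = 0.
    have ab : a *m b^T = u *m (P *m Q^T) *m u^T.
      by rewrite !mulmxA -mulmxA -trmx_mul uP uQ trmx_mul -mulmxA (mulmxA X) XY mul1mx.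
    have ba : b *m a^T = u *m (Q *m P^T) *m u^T.
      by rewrite -[b *m _]trmxK trmx_mul trmxK ab !trmx_mul !trmxK !mulmxA.
    by rewrite ab ba -mulmxDl -mulmxDr PQ mulmx0 mul0mx.
  have PQ2 : P *m Y2^T *m (Q *m X2^T)^T = P *m Q^T - s *m (a *m b^T) *m s^T.
    rewrite trmx_mul trmxK -mulmxA (mulmxA _ X2) YX2 mulmxBl mul1mx mulmxBr !mulmxA PY.
    by rewrite -!mulmxA -[X *m Q^T]trmxK trmx_mul trmxK QX trmx_mul.
  rewrite /isotropic_pair PQ2 -[Q *m _ *m _]trmxK trmx_mul trmxK PQ2 linearB /=.
  rewrite !trmx_mul !trmxK addrACA PQ add0r -opprD -!mulmxA -mulmxDr !(mulmxA _ _ s^T).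
  by rewrite -mulmxDl ab0 mul0mx mulmx0 oppr0.
have decP p (M : 'M_(p, n)) : M = M *m Y^T *m X + M *m Y2^T *m X2.
  by rewrite -!mulmxA -mulmxDr YX2 addrC subrK mulmx1.
have decQ p (M : 'M_(p, n)) : M = M *m X^T *m Y + M *m X2^T *m Y2.
  rewrite -!mulmxA -mulmxDr -[Y]trmxK -[Y2]trmxK -!trmx_mul -raddfD /=.
  by rewrite YX2 addrC subrK trmx1 mulmx1.
move=> [n' [G [H [h [a2 [b2 [w2 [[GH2 HG2] [sa2 sb2] Uab Ww]]]]]]]].
exists (n1 + n')%N, (col_mx X (G *m X2)), (col_mx Y (H *m Y2)), (k1 + h)%N.
exists (block_mx a 0 0 a2), (block_mx b 0 0 b2), (fun i => block_mx (w i) 0 0 (w2 i)).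
split.
- split.
    rewrite tr_col_mx mul_col_row XY !trmx_mul !mulmxA XY2 mul0mx.
    by rewrite -(mulmxA G X2 Y^T) X2Y1 mulmx0 -(mulmxA G X2) X2Y mulmx1 GH2 -scalar_mx_block.
  rewrite tr_col_mx mul_row_col trmx_mul !mulmxA -(mulmxA _ _ G) HG2 mulmx1 YX2.
  by rewrite addrC subrK.
- by split; apply: sign_mx_block.
- rewrite !mul_block_col !mul0mx !addr0 !add0r -block_mxEh.
  have /sub_row_mxP[t [tP tQ]] : (row_mx (a2 *m G) (b2 *m H) <= row_mx (P *m Y2^T) (Q *m X2^T))%MS.
    by rewrite Uab.
  have /sub_row_mxP[t' [tP' tQ']] : (row_mx (P *m Y2^T) (Q *m X2^T) <= row_mx (a2 *m G) (b2 *m H))%MS.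
    by rewrite Uab.
  apply/eqmxP/andP; split.
    apply/submxP; exists (row_mx s t'); rewrite block_mxEv mul_row_col !mul_mx_row add_row_mx.
    rewrite {1}[P]decP {1}[Q]decQ !mulmxA -PY -QX.
    by rewrite -(mulmxA t' a2) -tP' -(mulmxA t' b2) -tQ'.
  rewrite block_mxEv col_mx_sub; apply/andP; split; apply/sub_row_mxP.
    by exists u; rewrite uP uQ.
  exists (t *m (1%:M - s *m u)); rewrite -!(mulmxA t).
  have -> : (1%:M - s *m u) *m P = P *m Y2^T *m X2.
    by rewrite mulmxBl mul1mx -(mulmxA s) uP mulmxA -PY {1}[P]decP addrAC subrr add0r.
  have -> : (1%:M - s *m u) *m Q = Q *m X2^T *m Y2.
    by rewrite mulmxBl mul1mx -(mulmxA s) uQ mulmxA -QX {1}[Q]decQ addrAC subrr add0r.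
  by rewrite !mulmxA tP tQ !mulmxA.
move=> i; have [swi dwi wW Ww1] := wP i; have [sw2 dw2 eqW] := Ww i; split.
- exact: sign_mx_block.
- apply/implyP => co; rewrite is_diag_block_mx // !eqxx /=.
  by rewrite (implyP dwi) // (implyP dw2).
rewrite mul_block_col !mul0mx addr0 add0r.
apply/eqmxP; rewrite col_mx_sub; apply/and3P; split.
- rewrite -addsmxE {1}[W i]decP addmx_sub_adds //; first exact: submxMr.
  by rewrite mulmxA; apply: submxMr; rewrite eqW.
- by [].
- rewrite mulmxA; apply: (@submx_trans _ _ _ _ _ _ (W i *m Y2^T *m X2)).
    by apply: submxMr; rewrite eqW.
  rewrite -mulmxA YX2 mulmxBr mulmx1 addmx_sub // eqmx_opp mulmxA.
  by apply: submx_trans wW; apply: submxMr.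
Qed.

(** If every basis vector of X either lies in W_i or has a dual functional that
vanishes on W_i, then W_i is split, and its part in the first summand is spanned
by the basis vectors of the first kind. *)
Lemma split_coord coord k l n n1 k1 (I : finType)
    (P Q : 'M[F]_(k, n)) (W : I -> 'M[F]_(l, n)) (X Y : 'M[F]_(n1, n))
    (a b : 'M[F]_(k1, n1)) (u : 'M[F]_(k1, k)) (s : 'M[F]_(k, k1)) :
    (0 < n1)%N -> isotropic_pair P Q ->
    X *m Y^T = 1%:M -> sign_mx a -> sign_mx b ->
    u *m P = a *m X -> u *m Q = b *m Y ->
    P *m Y^T = s *m a -> Q *m X^T = s *m b ->
    (forall j i, (row j X <= W i)%MS \/ W i *m (row j Y)^T = 0) ->
  reducible coord P Q W.
Proof.
move=> n1_gt0 PQ XY sa sb uP uQ PY QX dich.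
pose w i : 'M[F]_n1 := diag_mx (\row_j (row j X <= W i)%MS%:R).
apply: (split_off (w := w) n1_gt0 PQ XY sa sb uP uQ PY QX) => i; split.
- move=> j j'; rewrite !mxE; case: eqP => _; last by rewrite mulr0n !inE eqxx.
  by rewrite mulr1n; case: (_ <= _)%MS; rewrite !inE eqxx ?orbT.
- by rewrite diag_mx_is_diag implybT.
- apply/row_subP => j; rewrite row_mul row_diag_mx -scalemxAl -rowE mxE.
  case: (boolP (row j X <= W i)%MS) => [jW|_]; first by rewrite scale1r.
  by rewrite scale0r sub0mx.
apply/submxP; exists (W i *m Y^T); rewrite mul_mx_diag; apply/matrixP => p j.
rewrite [RHS]mxE [X in _ * X]mxE; have [-> | W0] := dich j i; first by rewrite mulr1.
have -> : (W i *m Y^T) p j = (W i *m (row j Y)^T) p 0.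
  by rewrite !mxE; apply: eq_bigr => q _; rewrite !mxE.
by rewrite W0 mxE mul0r.
Qed.
End Standard.

(** * Flags with an isotropic line or a Lagrangian subspace *)

Section Flags.
Context {F : fieldType}.

Lemma isotropic_pairC k n (P Q : 'M[F]_(k, n)) :
  isotropic_pair P Q -> Q *m P^T = - (P *m Q^T).
Proof. by move=> PQ; apply/eqP; rewrite -addr_eq0 addrC PQ. Qed.

Lemma isotropic_alternating k n (P Q : 'M[F]_(k, n)) (v : 'rV_k) :
  2%:R != 0 :> F -> isotropic_pair P Q -> v *m P *m (v *m Q)^T = 0.
Proof.
move=> two PQ; set c := LHS.
have cN : c + c = 0.
  have {2}-> : c = c^T by rewrite [c]mx11_scalar tr_scalar_mx.
  rewrite /c !trmx_mul !trmxK -!mulmxA -mulmxDr !mulmxA.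
  by rewrite -mulmxDl PQ mul0mx mulmx0.
apply/eqP; move: cN; rewrite -mulr2n -scaler_nat => /eqP; rewrite scaler_eq0.
by rewrite (negPf two).
Qed.

Lemma standardizable_dim0 coord k l (I : finType) (P Q : 'M[F]_(k, 0))
    (W : I -> 'M[F]_(l, 0)) : standardizable coord P Q W.
Proof.
exists 0%N, 0, 0, k, 0, 0, (fun=> 0); split.
- by split; apply/matrixP => -[].
- by split; apply: sign_mx0.
- by rewrite [P]thinmx0 [Q]thinmx0 !mul0mx.
move=> i; split; [exact: sign_mx0 | by rewrite mx0_is_diag implybT |].
by rewrite [W i]thinmx0 mulmx0; apply/eqmxP; rewrite !sub0mx.
Qed.

Section Split.
Context {coord : bool} {k l n : nat} {I : finType}.
Context {P Q : 'M[F]_(k, n)} {W : I -> 'M[F]_(l, n)}.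
Context (PQ : isotropic_pair P Q) (chW : chain W).

(** A line orthogonal to U, with a complement containing the projection of U, takes
no part of U with it. *)
Lemma reducible_free (x psi : 'rV[F]_n) :
    x *m psi^T = 1%:M -> P *m psi^T = 0 -> Q *m x^T = 0 ->
    (forall i, (x <= W i)%MS \/ W i *m psi^T = 0) ->
  reducible coord P Q W.
Proof.
move=> x1 Ppsi Qx dich.
apply: (@split_coord _ coord k l n 1 0 I P Q W x psi 0 0 0 0) => //.
- exact: sign_mx0.
- exact: sign_mx0.
- by rewrite !mul0mx.
- by rewrite !mul0mx.
- by rewrite Ppsi mul0mx.
- by rewrite Qx mul0mx.
by move=> j i; rewrite !row_id.
Qed.

(** The vector of U with parameter u lies in X and spans the first summand. *)
Lemma reducible_left (u : 'rV[F]_k) :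
  u *m P != 0 -> u *m Q = 0 -> reducible coord P Q W.
Proof.
move=> nze uQ; have [psi x1 dich] := chain_functional chW nze.
apply: (@split_coord _ coord k l n 1 1 I P Q W (u *m P) psi 1%:M 0 u (P *m psi^T)) => //.
- exact: sign_mx1.
- exact: sign_mx0.
- by rewrite mul1mx.
- by rewrite mul0mx.
- by rewrite mulmx1.
- by rewrite mulmx0 trmx_mul mulmxA isotropic_pairC // mulNmx -mulmxA -trmx_mul uQ trmx0 mulmx0 oppr0.
by move=> j i; rewrite !row_id.
Qed.

(** The vector of U with parameter u lies in X^*; the first summand is spanned by a
vector x on which it takes the value 1. *)
Lemma reducible_right (u : 'rV[F]_k) :
  u *m P = 0 -> u *m Q != 0 -> reducible coord P Q W.
Proof.
move=> uP nzp; have [x x1 dich] := chain_vector chW nzp.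
apply: (@split_coord _ coord k l n 1 1 I P Q W x (u *m Q) 0 1%:M u (Q *m x^T)) => //.
- exact: sign_mx0.
- exact: sign_mx1.
- by rewrite mul0mx.
- by rewrite mul1mx.
- rewrite mulmx0 trmx_mul mulmxA -[X in X *m _]opprK -isotropic_pairC //.
  by rewrite mulNmx -mulmxA -trmx_mul uP trmx0 mulmx0 oppr0.
- by rewrite mulmx1.
by move=> j i; rewrite !row_id.
Qed.

(** The first summand is spanned by a and x, and takes from U the line of
a + phi, where a = uP and phi = uQ. The dual basis is psi, phi. As phi vanishes on
the projection of U to X, the part in the first summand of a vector of U is a
multiple of a + phi as soon as psi and x give the same coefficient. *)
Lemma reducible_pair (u : 'rV[F]_k) (x psi : 'rV[F]_n) :
    u *m P *m psi^T = 1%:M -> x *m psi^T = 0 -> u *m Q *m x^T = 1%:M ->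
    P *m (u *m Q)^T = 0 -> P *m psi^T = Q *m x^T ->
    (forall i, (u *m P <= W i)%MS \/ W i *m psi^T = 0) ->
    (forall i, (x <= W i)%MS \/ W i *m (u *m Q)^T = 0) ->
  reducible coord P Q W.
Proof.
move=> uPpsi xpsi uQx PuQ Ppsi dich1 dich2.
apply: (@split_coord _ coord k l n (1 + 1) 1 I P Q W (col_mx (u *m P) x)
  (col_mx psi (u *m Q)) (row_mx 1%:M 0) (row_mx 0 1%:M) u (P *m psi^T)) => //.
- rewrite tr_col_mx mul_col_row uPpsi xpsi -mulmxA PuQ mulmx0.
  have -> : x *m (u *m Q)^T = 1%:M by rewrite -[LHS]trmxK trmx_mul trmxK uQx trmx1.
  by rewrite -scalar_mx_block.
- move=> i j; case: (split_ordP j) => j' ->; rewrite ?row_mxEl ?row_mxEr.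
    exact: sign_mx1.
  exact: sign_mx0.
- move=> i j; case: (split_ordP j) => j' ->; rewrite ?row_mxEl ?row_mxEr.
    exact: sign_mx0.
  exact: sign_mx1.
- by rewrite mul_row_col mul1mx mul0mx addr0.
- by rewrite mul_row_col mul1mx mul0mx add0r.
- by rewrite tr_col_mx !mul_mx_row mulmx1 mulmx0 PuQ.
- rewrite tr_col_mx !mul_mx_row mulmx1 mulmx0 -Ppsi; congr row_mx.
  by rewrite trmx_mul mulmxA isotropic_pairC // mulNmx -mulmxA -trmx_mul PuQ oppr0.
by move=> j i; case: (split_ordP j) => j' ->; rewrite !(rowKu, rowKd) !row_id.
Qed.
End Split.

Theorem standardizable_line l n (I : finType) (P Q : 'rV[F]_n)
    (W : I -> 'M[F]_(l, n)) :
  2%:R != 0 :> F -> isotropic_pair P Q -> chain W -> standardizable true P Q W.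
Proof.
move=> two; elim/ltn_ind: n => -[|n] IHn in P Q W *.
  by move=> *; apply: standardizable_dim0.
move=> PQ chW; suff [r [X [Y [ltr _ PQ2]]]] : reducible true P Q W.
  apply; apply: IHn => // i j; have /orP[/submxMr s|/submxMr s] := chW i j.
    by rewrite s.
  by rewrite s orbT.
have [P0|nzP] := eqVneq P 0.
  have [Q0|nzQ] := eqVneq Q 0.
    have [|psi x1 dich] := @chain_functional _ _ _ _ _ chW (delta_mx 0 0).
      by apply/negP => /eqP/rowP/(_ 0)/eqP; rewrite !mxE !eqxx oner_eq0.
    by apply: (reducible_free PQ x1 _ _ dich); rewrite ?P0 ?Q0 mul0mx.
  by apply: (@reducible_right _ _ _ _ _ _ _ _ PQ chW 1%:M); rewrite mul1mx.
have [Q0|nzQ] := eqVneq Q 0.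
  by apply: (@reducible_left _ _ _ _ _ _ _ _ PQ chW 1%:M); rewrite mul1mx.
have [psi Ppsi dich_psi] := chain_functional chW nzP.
have [x xQ dich_x] := chain_vector chW nzQ.
have PQ0 : P *m Q^T = 0 by have := isotropic_alternating 1%:M two PQ; rewrite !mul1mx.
(* Correct psi by a multiple of Q so that it vanishes at x; this keeps the
   dichotomy, because psi already vanishes at x if x and not P is in W_i. *)
pose c := (x *m psi^T) 0 0.
have xpsi : x *m psi^T = c%:M by apply: mx11_scalar.
have Qx : Q *m x^T = 1%:M by rewrite -[LHS]trmxK trmx_mul trmxK xQ trmx1.
have cor p (M : 'M_(p, n.+1)) :
    M *m (psi - c *: Q)^T = M *m psi^T - c *: (M *m Q^T).
  by rewrite linearB /= [(_ *: _)^T]linearZ /= mulmxBr scalemxAr.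
apply: (@reducible_pair _ _ _ _ _ _ _ _ PQ 1%:M x (psi - c *: Q));
  rewrite ?mul1mx ?cor ?Ppsi ?PQ0 ?scaler0 ?subr0 //.
  by rewrite xpsi xQ scalemx1 subrr.
move=> i; have [|W0] := dich_psi i; first by left.
have [xW|WQ] := dich_x i; right; last by rewrite cor WQ W0 scaler0 subr0.
have c0 : c = 0.
  by rewrite /c; case/submxP: xW => D ->; rewrite -mulmxA W0 mulmx0 mxE.
by rewrite cor W0 c0 scale0r subr0.
Qed.

(** Among isotropic subspaces, this characterizes the Lagrangian ones without
mentioning dimensions, and it visibly passes to summands. *)
Definition maximal_isotropic k n (P Q : 'M[F]_(k, n)) : Prop :=
  forall x y : 'rV[F]_n, P *m y^T + Q *m x^T = 0 -> (row_mx x y <= row_mx P Q)%MS.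

Lemma maximal_isotropic_restrict k n r (P Q : 'M[F]_(k, n)) (X Y : 'M[F]_(r, n)) :
  X *m Y^T = 1%:M -> maximal_isotropic P Q ->
  maximal_isotropic (P *m Y^T) (Q *m X^T).
Proof.
move=> XY maxPQ x y; rewrite -!mulmxA -!trmx_mul => /maxPQ/sub_row_mxP[v [xv yv]].
apply/sub_row_mxP; exists v; rewrite !mulmxA -xv -yv -!mulmxA XY mulmx1; split=> //.
have -> : Y *m X^T = 1%:M by rewrite -[LHS]trmxK trmx_mul trmxK XY trmx1.
by rewrite mulmx1.
Qed.

Lemma maximal_isotropic_eqmx k k' n (P Q : 'M[F]_(k, n)) (P' Q' : 'M[F]_(k', n)) :
  (row_mx P Q :=: row_mx P' Q')%MS -> maximal_isotropic P Q -> maximal_isotropic P' Q'.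
Proof.
move=> eqU maxPQ x y xy; rewrite -eqU; apply: maxPQ.
have /sub_row_mxP[D [-> ->]] : (row_mx P Q <= row_mx P' Q')%MS by rewrite eqU.
by rewrite -!mulmxA -mulmxDr xy mulmx0.
Qed.

Lemma isotropic_pair_sub k k' n (P Q : 'M[F]_(k, n)) (P' Q' : 'M[F]_(k', n)) :
  (row_mx P' Q' <= row_mx P Q)%MS -> isotropic_pair P Q -> isotropic_pair P' Q'.
Proof.
case/sub_row_mxP=> D [-> ->] PQ; rewrite /isotropic_pair !trmx_mul !mulmxA.
by rewrite -mulmxDl -!(mulmxA D) -mulmxDr PQ mulmx0 mul0mx.
Qed.

(** U is the graph of a symplectic form Omega. A hyperbolic pair e, f splits the flag
if e lies in all the nonzero members of the flag, and f in the smallest member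
that is not orthogonal to e. *)
Lemma reducible_hyperbolic coord l n (I : finType) (Omega : 'M[F]_n)
    (W : I -> 'M[F]_(l, n)) :
    2%:R != 0 :> F -> (0 < n)%N -> isotropic_pair 1%:M Omega ->
    Omega \in unitmx -> chain W ->
  reducible coord 1%:M Omega W.
Proof.
move=> two n_gt0 PQ unitO chW; have [e nze dich_e] := chain_first chW n_gt0.
have nzO : e *m Omega != 0.
  by apply: contraNneq nze => eO; rewrite -(mulmxK unitO e) eO mul0mx.
have [f fO dich_f] := chain_vector chW nzO.
have skew : Omega^T = - Omega.
  by have := isotropic_pairC PQ; rewrite mul1mx trmx1 mulmx1 => OT; rewrite {2}OT opprK.
have alt (v : 'rV_n) : v *m Omega *m v^T = 0.
  have := isotropic_alternating v two PQ; rewrite mulmx1 trmx_mul skew.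
  by rewrite mulNmx mulmxN mulmxA => /eqP; rewrite oppr_eq0 => /eqP.
have eOf : e *m Omega *m f^T = 1%:M by rewrite -[LHS]trmxK trmx_mul trmxK fO trmx1.
have fOe : f *m Omega *m e^T = - 1%:M.
  by rewrite -fO trmx_mul skew mulNmx mulmxN opprK mulmxA.
pose X : 'M_(1 + 1, n) := col_mx e f.
pose Y : 'M_(1 + 1, n) := col_mx (- (f *m Omega)) (e *m Omega).
apply: (@split_coord _ coord n l n (1 + 1) (1 + 1) I 1%:M Omega W X Y
   1%:M (block_mx 0 1%:M (- 1%:M) 0) X Y^T) => //.
- rewrite /X /Y tr_col_mx mul_col_row linearN /= !mulmxN !trmx_mul skew !mulNmx !mulmxN !mulmxA.
  by rewrite !opprK eOf fOe !alt !oppr0 opprK -scalar_mx_block.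
- exact: sign_mx1.
- move=> i j; case: (split_ordP i) => i' ->; case: (split_ordP j) => j' ->;
    rewrite ?(block_mxEul, block_mxEur, block_mxEdl, block_mxEdr) ?ord1 !mxE ?eqxx ?oppr0 ?inE ?eqxx ?orbT //.
- by rewrite mulmx1 mul1mx.
- by rewrite /X /Y mul_col_mx mul_block_col !mul0mx add0r addr0 mul1mx mulNmx mul1mx opprK.
- by rewrite mul1mx mulmx1.
- rewrite /X /Y !tr_col_mx mul_mx_row mul_row_block !mulmx0 add0r addr0 mulmx1 mulmxN mulmx1.
  by rewrite linearN /= !trmx_mul skew !mulNmx !opprK.
move=> j i; case: (split_ordP j) => j' ->; rewrite /X /Y !(rowKu, rowKd) !row_id //.
by have [|->] := dich_e i; [left | right; rewrite mul0mx].
Qed.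

Lemma kermx_mul_neq0 k p q (A : 'M[F]_(k, p)) (D : 'M[F]_(k, q)) :
  kermx A *m D != 0 -> exists2 u : 'rV_k, u *m A = 0 & u *m D != 0.
Proof.
case/rowV0Pn=> v /submxP[x ->] nz; exists (x *m kermx A); last by rewrite -mulmxA.
by rewrite -mulmxA mulmx_ker mulmx0.
Qed.

Lemma kermx_mul_eq0 k p q r (A : 'M[F]_(k, p)) (D : 'M[F]_(k, q)) (V : 'M_(r, k)) :
  kermx A *m D = 0 -> V *m A = 0 -> V *m D = 0.
Proof. by move=> KD /sub_kermxP/submxP[x ->]; rewrite -mulmxA KD mulmx0. Qed.

Theorem standardizable_lagrangian k l n (I : finType) (P Q : 'M[F]_(k, n))
    (W : I -> 'M[F]_(l, n)) :
    2%:R != 0 :> F -> isotropic_pair P Q -> maximal_isotropic P Q -> chain W ->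
  standardizable true P Q W.
Proof.
move=> two; elim/ltn_ind: n => -[|n] IHn in k P Q W *.
  by move=> *; apply: standardizable_dim0.
move=> PQ maxPQ chW.
suff [k' [P' [Q' [eqU [r [X [Y [ltr XY PQ2 redW]]]]]]]] :
    exists k' (P' Q' : 'M_(k', n.+1)),
      (row_mx P Q :=: row_mx P' Q')%MS /\ reducible true P' Q' W.
  apply: (@standardizable_eqmx _ true k' k l l n.+1 I P' Q' P Q W W) => //.
  apply/redW/IHn => //; first exact/(maximal_isotropic_restrict XY)/(maximal_isotropic_eqmx eqU).
  by move=> i j; have /orP[/submxMr s|/submxMr s] := chW i j; rewrite s ?orbT.
have [KPQ|/kermx_mul_neq0[u uP uQ]] := eqVneq (kermx P *m Q) 0; last first.
  by exists k, P, Q; split=> //; apply: reducible_right uP uQ.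
have [KQP|/kermx_mul_neq0[u uQ uP]] := eqVneq (kermx Q *m P) 0; last first.
  by exists k, P, Q; split=> //; apply: reducible_left uP uQ.
(* U meets X^* trivially and is maximal, so its projection to X is onto. *)
have [|x Px] := @solve_right _ _ _ _ P^T 1%:M.
  move=> y yP; have : (row_mx 0 y <= row_mx P Q)%MS.
    by apply: maxPQ; rewrite trmx0 mulmx0 addr0 -[P]trmxK -trmx_mul yP trmx0.
  by case/sub_row_mxP=> u [/esym uP ->]; rewrite mulmx1; apply: kermx_mul_eq0 uP.
pose L := x^T; have LP : L *m P = 1%:M by rewrite -[P]trmxK -trmx_mul Px trmx1.
have eqU : (row_mx P Q :=: row_mx 1%:M (L *m Q))%MS.
  apply/eqmxP/andP; split; apply/sub_row_mxP; last by exists L; rewrite LP.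
  exists P; rewrite mulmx1; split=> //; apply/eqP.
  rewrite -subr_eq0 mulmxA -[X in X - _]mul1mx -mulmxBl; apply/eqP.
  by apply: kermx_mul_eq0 KPQ _; rewrite mulmxBl mul1mx -mulmxA LP mulmx1 subrr.
exists n.+1, 1%:M, (L *m Q); split=> //; apply: reducible_hyperbolic => //.
  by apply: isotropic_pair_sub PQ; rewrite eqU.
rewrite -row_free_unit -kermx_eq0 -[kermx _]mulmx1 -LP mulmxA; apply/eqP.
by apply: kermx_mul_eq0 KQP _; rewrite -mulmxA mulmx_ker.
Qed.
End Flags.

(** * A degenerate form on the isotropic subspace *)

Section Subspace.
Context {F : fieldType}.

Lemma chain_const l n (W : 'M[F]_(l, n)) : chain (fun _ : unit => W).
Proof. by move=> i j; rewrite submx_refl. Qed.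

Section Radical.
Context {k l n : nat} {P Q : 'M[F]_(k, n)} {W : 'M[F]_(l, n)}.
Context (two : 2%:R != 0 :> F) (PQ : isotropic_pair P Q).
Context (freeP : row_free P) (freeQ : row_free Q).

(* K is the space of the parameters v for which vP belongs to W. *)
Context {K : 'M[F]_k}.
Context (subK : forall v : 'rV_k, (v <= K)%MS = (v *m P <= W)%MS).

(* u is a parameter in the radical of the form P Q^T. *)
Context (u : 'rV[F]_k) (nzu : u != 0) (uPQ : u *m P *m Q^T = 0).

Let PuQ : P *m (u *m Q)^T = 0.
Proof.
have QuP : Q *m P^T *m u^T = (u *m P *m Q^T)^T by rewrite !trmx_mul trmxK mulmxA.
by rewrite trmx_mul mulmxA -[_ *m Q^T]opprK -isotropic_pairC // mulNmx QuP uPQ trmx0 oppr0.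
Qed.

Let inj_mul q (A : 'M[F]_(k, n)) (V : 'M[F]_(q, k)) :
  row_free A -> V *m A = 0 -> V = 0.
Proof. by move/row_freeP=> [B AB] VA; rewrite -[V]mulmx1 -AB mulmxA VA mul0mx. Qed.

(** When m = uP is in W, its dual functional need not vanish on W, and x only has to
suit W and the functional uQ. *)
Lemma reducible_radical_in : (u *m P <= W)%MS ->
  reducible false P Q (fun _ : unit => W).
Proof.
move=> uW; have nzq : u *m Q != 0.
  by apply: contraNneq nzu => uQ; apply/eqP/(inj_mul freeQ).
have [x xq dich] := chain_vector (chain_const W) nzq.
have [|psit] := @solve_right _ _ _ 1 (col_mx P x) (col_mx (Q *m x^T) 0).
  move=> v; rewrite -[v]hsubmxK !mul_row_col mulmx0 addr0 => eq0.
  have vr : rsubmx v = 0.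
    move/(congr1 (mulmxr (u *m Q)^T)): eq0.
    by rewrite /= mulmxDl -!mulmxA PuQ mulmx0 add0r xq mulmx1 mul0mx.
  by move: eq0; rewrite vr mul0mx addr0 => /(inj_mul freeP)->; rewrite mul0mx.
rewrite mul_col_mx => /eq_col_mx[Ppsi xpsi].
have uQx : u *m Q *m x^T = 1%:M by rewrite -[LHS]trmxK trmx_mul trmxK xq trmx1.
apply: (@reducible_pair _ _ _ _ _ _ _ _ _ PQ u x psit^T) => //; rewrite ?trmxK //.
  by rewrite -mulmxA Ppsi mulmxA.
by move=> _; left.
Qed.

(** The dual functional of m = uP is taken to vanish on W, whereas on the projection
of U it is prescribed by x. These conditions are compatible if x is orthogonal to
the vectors of U that project into W. *)
Lemma reducible_radical_out (x : 'rV[F]_n) :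
    u *m Q *m x^T = 1%:M -> K *m Q *m x^T = 0 ->
    ((x <= W)%MS \/ W *m (u *m Q)^T = 0) ->
  reducible false P Q (fun _ : unit => W).
Proof.
move=> uQx KQx dich.
have [|psit] := @solve_right _ _ _ 1 (col_mx P (col_mx W x)) (col_mx (Q *m x^T) (col_mx 0 0)).
  move=> v; rewrite -[v]hsubmxK -[rsubmx v]hsubmxK !mul_row_col !mulmx0 !addr0 => eq0.
  suff /submxP[y ->] : (lsubmx v <= K)%MS by rewrite -mulmxA (mulmxA K) KQx mulmx0.
  have eqP : lsubmx v *m P =
      - (lsubmx (rsubmx v) *m W + rsubmx (rsubmx v) *m x).
    by apply/eqP; rewrite -addr_eq0 eq0.
  rewrite subK eqP eqmx_opp addmx_sub ?submxMl //.
  case: dich => [xW|WuQ]; first by apply: submx_trans xW; apply: submxMl.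
  have -> : rsubmx (rsubmx v) = 0; last by rewrite mul0mx sub0mx.
  have xq : x *m (u *m Q)^T = 1%:M by rewrite -[LHS]trmxK trmx_mul trmxK uQx trmx1.
  move/(congr1 (mulmxr (u *m Q)^T)): eq0.
  by rewrite /= !mulmxDl -!mulmxA PuQ WuQ !mulmx0 !add0r xq mulmx1 mul0mx.
rewrite !mul_col_mx => /eq_col_mx[Ppsi /eq_col_mx[Wpsi xpsi]].
apply: (@reducible_pair _ _ _ _ _ _ _ _ _ PQ u x psit^T) => //; rewrite ?trmxK //.
  by rewrite -mulmxA Ppsi mulmxA.
by move=> _; right.
Qed.

(** The functionals uQ and vQ agree on W, and vP is in W. So no x in W on which uQ
takes the value 1 is orthogonal to all the vectors of U that project into W, as
[reducible_radical_out] requires. For such an x, choose z so that zP pairs with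
these vectors of U as x does; then uP, vP, zP and x span a summand, and vP and x
span its part of W. *)
Lemma reducible_radical_quad (v : 'rV[F]_k) :
    (forall y : 'rV_k, y *m P *m Q^T = 0 -> (y *m P <= W)%MS -> y = 0) ->
    W *m (u *m Q)^T != 0 -> (v *m P <= W)%MS ->
    v *m Q *m W^T = u *m Q *m W^T ->
  reducible false P Q (fun _ : unit => W).
Proof.
move=> radW nzWu vW vQW; have [x /submxP[y xW] xq] := dual_vector nzWu.
have uQx : u *m Q *m x^T = 1%:M by rewrite -[LHS]trmxK trmx_mul trmxK xq trmx1.
have vQx : v *m Q *m x^T = 1%:M by rewrite -uQx xW trmx_mul !mulmxA vQW.
have QPt : Q *m P^T = - (P *m Q^T) by apply: isotropic_pairC.
have [|zt zP] := @solve_right _ _ _ 1 (K *m Q *m P^T) (K *m Q *m x^T).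
  move=> t tKQP; suff tK : t *m K = 0 by rewrite -!(mulmxA K) mulmxA tK mul0mx.
  apply: radW; last by rewrite -subK submxMl.
  apply/eqP; rewrite -oppr_eq0 -mulmxA -mulmxN -QPt mulmxA; apply/eqP.
  by rewrite -!(mulmxA t) -tKQP !mulmxA.
(* Subtracting a multiple of u, which is in the radical, achieves that x and z are
   orthogonal. *)
pose c := (zt^T *m Q *m x^T) 0 0; pose z := zt^T - c *: u.
have PQu : Q *m P^T *m u^T = 0.
  by rewrite QPt mulNmx -mulmxA -trmx_mul PuQ oppr0.
have Kz : K *m Q *m P^T *m z^T = K *m Q *m x^T.
  rewrite linearB /= trmxK [(_ *: _)^T]linearZ /= mulmxBr zP -scalemxAr.
  by rewrite -(mulmxA K Q P^T) -(mulmxA K _ u^T) PQu mulmx0 scaler0 subr0.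
have zQx : z *m Q *m x^T = 0.
  rewrite !mulmxBl -!scalemxAl uQx [X in X - _]mx11_scalar -/c scalemx1 subrr //.
clearbody z.
have vKz : v *m Q *m P^T *m z^T = 1%:M.
  have /submxP[t vt] : (v <= K)%MS by rewrite subK.
  rewrite vt -(mulmxA t K Q) -(mulmxA t (K *m Q) P^T) -(mulmxA t _ z^T) Kz.
  by rewrite !mulmxA -vt.
have zPv : z *m P *m (v *m Q)^T = 1%:M.
  by rewrite -[LHS]trmxK trmx_mul trmxK [(z *m P)^T]trmx_mul !mulmxA vKz trmx1.
have vPz : v *m P *m (z *m Q)^T = - 1%:M.
  rewrite trmx_mul mulmxA -(mulmxA v) -[P *m Q^T]opprK -QPt mulmxN mulNmx.
  by rewrite !mulmxA vKz.
have uPo q (V : 'M_(q, k)) : u *m P *m (V *m Q)^T = 0.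
  by rewrite trmx_mul mulmxA uPQ mul0mx.
have [|psit] := @solve_right _ _ _ 1 (col_mx P W)
    (col_mx (Q *m x^T + P *m (z *m Q)^T) 0).
  move=> t; rewrite -[t]hsubmxK !mul_row_col mulmx0 addr0 => eq0.
  have /submxP[t' ->] : (lsubmx t <= K)%MS.
    have eqP : lsubmx t *m P = - (rsubmx t *m W).
      by apply/eqP; rewrite -addr_eq0 eq0.
    by rewrite subK eqP eqmx_opp submxMl.
  rewrite -mulmxA mulmxDr !mulmxA -Kz trmx_mul !mulmxA -mulmxDl.
  by rewrite -!(mulmxA K) -mulmxDr QPt addNr mulmx0 mul0mx mulmx0.
rewrite mul_col_mx -[psit]trmxK => /eq_col_mx[]; move: psit^T => psi Ppsi Wpsi.
pose X : 'M_((1 + 1) + (1 + 1), n) :=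
  col_mx (col_mx (u *m P) (v *m P)) (col_mx (z *m P) x).
pose Y : 'M_((1 + 1) + (1 + 1), n) :=
  col_mx (col_mx psi (- (z *m Q))) (col_mx (v *m Q - u *m Q) (u *m Q)).
(* The coordinates a in X and b in X^* of the vectors of U with parameters u, v, z. *)
pose a : 'M[F]_((1 + 1) + 1, (1 + 1) + (1 + 1)) :=
  block_mx 1%:M 0 0 (row_mx 1%:M 0).
pose b : 'M[F]_((1 + 1) + 1, (1 + 1) + (1 + 1)) :=
  block_mx 0 (block_mx 0 1%:M 1%:M 1%:M) (row_mx 0 (- 1%:M)) 0.
have VPu q (V : 'M_(q, k)) : V *m P *m (u *m Q)^T = 0 by rewrite -mulmxA PuQ mulmx0.
have alt := isotropic_alternating _ two PQ.
have VPpsi (t : 'rV_k) : t *m P *m psi^T = t *m Q *m x^T + t *m P *m (z *m Q)^T.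
  by rewrite -mulmxA Ppsi mulmxDr !mulmxA.
have xpsi : x *m psi^T = 0 by rewrite xW -mulmxA Wpsi mulmx0.
have zQN : (- (z *m Q))^T = - (z *m Q)^T by rewrite linearN.
have vuQ : (v *m Q - u *m Q)^T = (v *m Q)^T - (u *m Q)^T by rewrite linearB.
have xV (t : 'rV_k) : x *m (t *m Q)^T = (t *m Q *m x^T)^T by rewrite [RHS]trmx_mul trmxK.
apply: (@split_coord _ false k l n ((1 + 1) + (1 + 1)) ((1 + 1) + 1) unit P Q
   (fun=> W) X Y a b (col_mx (col_mx u v) z)
   (P *m (col_mx (col_mx psi (- (z *m Q))) (v *m Q - u *m Q))^T)) => //.
- rewrite /X /Y !tr_col_mx !mul_col_row zQN vuQ !mulmxN !mulmxBr.
  rewrite !VPu !VPpsi !xpsi !xV uQx vQx zQx !alt vPz zPv !uPo.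
  rewrite trmx0 trmx1 !(addr0, add0r, subr0, oppr0, opprK, subrr).
  by rewrite -!scalar_mx_block block_mx0 -scalar_mx_block.
- apply: sign_mx_block; first exact: sign_mx1.
  move=> i j; case: (split_ordP j) => j' ->; rewrite ?row_mxEl ?row_mxEr.
    exact: sign_mx1.
  exact: sign_mx0.
- move=> i j; case: (split_ordP i) => i' ->; case: (split_ordP j) => j' ->;
    rewrite ?(block_mxEul, block_mxEur, block_mxEdl, block_mxEdr);
    case: (split_ordP j') => j'' ->; try (case: (split_ordP i') => i'' ->);
    rewrite ?(block_mxEul, block_mxEur, block_mxEdl, block_mxEdr, row_mxEl, row_mxEr) !mxE;
    by rewrite ?ord1 ?eqxx ?oppr0 !inE ?eqxx ?orbT.
- by rewrite /a /X mul_block_col !mul0mx addr0 add0r mul_row_col !mul1mx mul0mx addr0 !mul_col_mx.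
- rewrite /b /Y mul_block_col !mul0mx addr0 add0r mul_block_col mul_row_col !mul_col_mx.
  by rewrite !mul0mx !mul1mx !add0r mulNmx mul1mx opprK subrK.
- rewrite /Y /a !tr_col_mx !mul_mx_row mul_row_block !mulmx0 addr0 add0r mulmx1.
  by rewrite mul_mx_row mulmx1 mulmx0 PuQ.
- rewrite /X /b !tr_col_mx !mul_mx_row mul_row_block !mulmx0 addr0 add0r.
  rewrite mul_mx_row mul_row_block !mulmx0 !mulmx1 add0r mulmxN mulmx1.
  rewrite Ppsi zQN vuQ mulmxN mulmxBr PuQ subr0 .
  have PQu0 : P *m Q^T *m u^T = 0 by rewrite -mulmxA -trmx_mul PuQ.
  by rewrite !trmx_mul !mulmxA !QPt !mulNmx PQu0 oppr0 addrK.
move=> j i; case: (split_ordP j) => j1 ->; case: (split_ordP j1) => j2 ->;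
  rewrite /X /Y !(rowKu, rowKd) !row_id; [by right | by left | right | by left; rewrite xW submxMl].
have -> : v *m Q - u *m Q = (v - u) *m Q by rewrite mulmxBl.
by rewrite -[LHS]trmxK trmx_mul trmxK !mulmxBl vQW subrr trmx0.
Qed.

End Radical.

(** Let m = uP. Either some nonzero element of the radical projects into W, or an x as
required by [reducible_radical_out] exists, or the functional uQ agrees on W with
a combination of the functionals vQ for which vP is in W. *)
Lemma reducible_radical k l n (P Q : 'M[F]_(k, n)) (W : 'M[F]_(l, n)) (u : 'rV_k) :
    2%:R != 0 :> F -> isotropic_pair P Q -> row_free P -> row_free Q ->
    u != 0 -> u *m P *m Q^T = 0 ->
  reducible false P Q (fun _ : unit => W).
Proof.
move=> two PQ freeP freeQ nzu uPQ.
have [K subK] : exists K : 'M[F]_k, forall v : 'rV_k, (v <= K)%MS = (v *m P <= W)%MS.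
  by exists (kermx (P *m cokermx W)) => v; rewrite sub_kermx mulmxA submxE.
have [cap0|/rowV0Pn[v]] := eqVneq (kermx (P *m Q^T) :&: K)%MS 0; last first.
  rewrite sub_capmx sub_kermx subK mulmxA => /andP[/eqP vPQ vW] nzv.
  exact: (reducible_radical_in PQ freeP freeQ nzv vPQ vW).
have radW (y : 'rV_k) : y *m P *m Q^T = 0 -> (y *m P <= W)%MS -> y = 0.
  move=> yPQ yW; apply/eqP; rewrite -submx0 -cap0 sub_capmx sub_kermx subK yW.
  by rewrite mulmxA yPQ eqxx.
have [WuQ|nzWu] := eqVneq (W *m (u *m Q)^T) 0.
  have [|lam ulam Klam] := @functional_off _ _ _ u K.
    by apply: contra nzu; rewrite subK => /radW->.
  have /row_freeP[R QR] := freeQ.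
  apply: (@reducible_radical_out _ _ _ P Q W PQ K subK u uPQ (R *m lam^T)^T).
  - by rewrite trmxK mulmxA -(mulmxA u) QR mulmx1.
  - by rewrite trmxK mulmxA -(mulmxA K) QR mulmx1.
  by right.
have [/submxP[y uy]|off] := boolP (u *m Q *m W^T <= K *m Q *m W^T)%MS.
  apply: (@reducible_radical_quad _ _ _ P Q W two PQ K subK u uPQ (y *m K)) => //.
    by rewrite -subK submxMl.
  by rewrite uy !mulmxA.
have [y uy Ky] := functional_off off.
apply: (@reducible_radical_out _ _ _ P Q W PQ K subK u uPQ (y *m W)).
- by rewrite trmx_mul mulmxA.
- by rewrite trmx_mul mulmxA.
by left; apply: submxMl.
Qed.
End Subspace.

(** * A nondegenerate form on the isotropic subspace *)

Section Symplectic.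
Context {F : fieldType}.

(** The matrix sel selects the rows with index in J. *)
Lemma selection_mx k (J : pred 'I_k) :
  exists c (sel : 'M[F]_(c, k)),
    [/\ sign_mx sel^T, sel *m sel^T = 1%:M &
        sel^T *m sel = diag_mx (\row_i (J i)%:R)].
Proof.
pose ev := @enum_val _ J.
exists #|J|, (rowsub ev 1%:M); split.
- by move=> i j; rewrite !mxE; case: (_ == _); rewrite !inE eqxx ?orbT.
- rewrite mul_rowsub_mx mul1mx; apply/matrixP => p q; rewrite !mxE.
  by rewrite (inj_eq enum_val_inj) eq_sym.
apply/matrixP => i j; rewrite !mxE.
under eq_bigr do rewrite !mxE.
rewrite -(@big_enum_val _ _ _ _ J (fun q => (q == i)%:R * (q == j)%:R)) big_mkcond (bigD1 i) //= eqxx mul1r.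
rewrite big1 ?addr0 => [|q /negPf->]; last by rewrite mul0r; case: ifP.
by rewrite unfold_in; case: (J i); case: eqP => _; rewrite ?mulr1n ?mulr0n.
Qed.

(** With C the kernel of Q^T and A the row space of P, X is the direct sum of A and C.
In a basis of A adapted to the form and to the flag S0 in S1, the basis vectors e_i in
S1 lift to vectors e_i + t_i of W, with t_i in C. Those t_i with e_i not in S0
form a basis of C, and the others vanish; so the e_i and the nonzero t_i together
form an adapted basis. The matrix T has rows t_i up to scaling by signs, and zero rows
for the e_i outside S1. *)
Lemma standardizable_symplectic k l n (P Q : 'M[F]_(k, n)) (W : 'M[F]_(l, n)) :
    2%:R != 0 :> F -> isotropic_pair P Q -> Q *m P^T \in unitmx ->
    (forall c : 'rV_n, c *m Q^T = 0 -> (c <= W)%MS -> c = 0) ->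
    (forall c : 'rV_n, c *m Q^T = 0 -> (c <= P + W)%MS) ->
  standardizable false P Q (fun _ : unit => W).
Proof.
move=> two PQ; set O := Q *m P^T => unitO CW CPW.
have CW' p (V : 'M_(p, n)) : V *m Q^T = 0 -> (V <= W)%MS -> V = 0.
  move=> VQ VW; apply/row_matrixP => i; rewrite row0; apply: CW.
    by rewrite -row_mul VQ row0.
  exact: submx_trans (row_sub i V) VW.
have CPW' p (V : 'M_(p, n)) : V *m Q^T = 0 -> (V <= P + W)%MS.
  by move=> VQ; apply/row_subP => i; apply: CPW; rewrite -row_mul VQ row0.
pose C := kermx Q^T.
have subC p (V : 'M_(p, n)) : (V <= C)%MS = (V *m Q^T == 0) by rewrite sub_kermx.
have CQ : C *m Q^T = 0 by apply: mulmx_ker.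
clearbody C.
have [S0 subS0] : exists S0 : 'M[F]_k, forall p (V : 'M_(p, k)), (V <= S0)%MS = (V *m P <= W)%MS.
  by exists (kermx (P *m cokermx W)) => p V; rewrite sub_kermx mulmxA submxE.
have [S1 subS1] : exists S1 : 'M[F]_k, forall p (V : 'M_(p, k)), (V <= S1)%MS = (V *m P <= W + C)%MS.
  by exists (kermx (P *m cokermx (W + C)%MS)) => p V; rewrite sub_kermx mulmxA submxE.
have S01 : (S0 <= S1)%MS.
  by rewrite subS1; apply: submx_trans (addsmxSl W C); rewrite -subS0.
have PQO : P *m Q^T = O^T by rewrite trmx_mul trmxK.
have skewO : O^T = - O by rewrite -PQO /O (isotropic_pairC PQ) opprK.
clearbody O.
have [] := @standardizable_lagrangian _ k k k bool 1%:M O (fun i : bool => if i then S1 else S0) two.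
- by rewrite /isotropic_pair trmx1 mulmx1 mul1mx skewO addNr.
- move=> x y; rewrite mul1mx => /eqP; rewrite addr_eq0 => /eqP yO.
  apply/sub_row_mxP; exists x; rewrite mulmx1; split=> //.
  by rewrite -[y]trmxK yO linearN /= trmx_mul trmxK skewO mulmxN opprK.
- by move=> [] [] /=; rewrite ?submx_refl ?S01 ?orbT.
move=> k' [G [H [h [a [b [w [[GH HG] [sa sb] eqU Ww]]]]]]].
have /sub_row_mxP[D [D1 DO]] : (row_mx 1%:M O <= row_mx (a *m G) (b *m H))%MS by rewrite eqU.
have bH : b *m H = a *m G *m O.
  have /sub_row_mxP[D' [-> ->]] : (row_mx (a *m G) (b *m H) <= row_mx 1%:M O)%MS by rewrite eqU.
  by rewrite mulmx1.
have [_ /= /diag_mxP[r0 def0] eqS0] := Ww false.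
have [s1 /= /diag_mxP[r1 def1] eqS1] := Ww true.
set d1 := w true in s1 def1 eqS1; set d0 := w false in def0 eqS0.
have /sub_addsmxP[[A1 A2] /= decE] : (d1 *m G *m P <= W + C)%MS by rewrite -subS1 eqS1.
pose T := - (A2 *m C).
have TQ : T *m Q^T = 0 by rewrite mulNmx -mulmxA CQ mulmx0 oppr0.
have ETW : ((d1 *m G *m P + T)%R <= W)%MS by rewrite decE addrK submxMl.
clearbody T.
have T0 j : (row j (d1 *m G *m P) <= W)%MS -> row j T = 0.
  move=> jW; apply: CW; first by rewrite -row_mul TQ row0.
  rewrite -[row j T](addKr (row j (d1 *m G *m P))) -linearD /=.
  rewrite addmx_sub ?eqmx_opp //; exact: submx_trans (row_sub _ _) ETW.
have rowdG p q (r : 'rV_p) (M : 'M[F]_(p, q)) j : row j (diag_mx r *m M) = r 0 j *: row j M.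
  by rewrite row_mul row_diag_mx -scalemxAl -rowE.
have T0r j : r1 0 j = 0 \/ r0 0 j <> 0 -> row j T = 0.
  move=> [r1j|/eqP r0j]; apply: T0; rewrite -mulmxA def1 rowdG.
    by rewrite r1j scale0r sub0mx.
  apply: scalemx_sub; rewrite row_mul -subS0 -[row j G](scalerK r0j) -rowdG -def0.
  by apply: scalemx_sub; rewrite eqS0 row_sub.
have subT p (V : 'M_(p, n)) : V *m Q^T = 0 -> (V <= T)%MS.
  move=> VQ; have /sub_addsmxP[[x y] /= decV] := CPW' _ _ VQ.
  have /submxP[z xz] : (x <= d1 *m G)%MS.
    rewrite -eqS1 subS1; have -> : x *m P = - (y *m W) + V by rewrite decV addrC addrK.
    by apply: addmx_sub_adds; rewrite ?eqmx_opp ?submxMl // subC VQ.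
  have -> : V = - z *m T; last exact: submxMl.
  apply/eqP; rewrite -subr_eq0 mulNmx opprK; apply/eqP; apply: CW'.
    by rewrite mulmxDl VQ -mulmxA TQ mulmx0 addr0.
  rewrite decV xz addrAC -!mulmxA -mulmxDr addmx_sub ?submxMl //.
  by rewrite !mulmxA; apply: submx_trans ETW; rewrite submxMl.
have eqW : (W :=: (d1 *m G *m P + T)%R)%MS.
  apply/eqmxP; rewrite ETW andbT; pose M := W *m Q^T *m invmx O^T.
  pose N := W - M *m P.
  have NQ : N *m Q^T = 0.
    by rewrite mulmxBl -mulmxA PQO mulmxKV ?subrr // unitmx_tr.
  have /submxP[y My] : (M <= d1 *m G)%MS.
    rewrite -eqS1 subS1; have -> : M *m P = W - N by rewrite opprB addrC subrK.
    by apply: addmx_sub_adds; rewrite // eqmx_opp subC NQ.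
  apply/submxP; exists y; apply/eqP; rewrite -subr_eq0; apply/eqP; apply: CW'; last first.
    by rewrite addmx_sub // eqmx_opp mulmx_sub.
  by rewrite mulmxDr (mulmxA y _ P) -My opprD addrA mulmxDl NQ add0r mulNmx -mulmxA TQ mulmx0 oppr0.
have [c [sel [ssel selK selT]]] := selection_mx (fun j => row j T != 0).
have selTT : sel^T *m (sel *m T) = T.
  apply/row_matrixP => j; rewrite mulmxA selT rowdG mxE.
  by case: eqVneq => [->|_]; rewrite ?scaler0 ?scale1r.
have freeT : row_free (sel *m T).
  rewrite -kermx_eq0; set N := kermx _; pose mu := N *m sel.
  suff mu0 : mu = 0 by rewrite -[N]mulmx1 -selK mulmxA -/mu mu0 mul0mx.
  have muT : mu *m T = 0 by rewrite -mulmxA mulmx_ker.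
  have /submxP[nu eq_mu] : (mu *m (d1 *m G) <= d0 *m G)%MS.
    rewrite -eqS0 subS0 -mulmxA -[X in (X <= _)%MS]addr0 -muT -mulmxDr.
    by rewrite mulmx_sub.
  have {}eq_mu : mu *m d1 = nu *m d0.
    move/(congr1 (mulmxr H^T)): eq_mu.
    by rewrite /= !mulmxA -!(mulmxA _ G) GH !mulmx1.
  have mu_sel : mu = mu *m (sel^T *m sel) by rewrite mulmxA -(mulmxA N) selK mulmx1.
  apply/matrixP => p j; rewrite [RHS]mxE.
  have [Tj|Tj] := eqVneq (row j T) 0.
    by rewrite mu_sel selT mul_mx_diag !mxE Tj eqxx mulr0.
  move/matrixP/(_ p j): eq_mu; rewrite def0 def1 !mul_mx_diag [LHS]mxE [RHS]mxE.
  have -> : r0 0 j = 0.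
    by apply/eqP; apply: contraNT Tj => /eqP r0j; apply/eqP/T0r; right.
  rewrite mulr0 => /eqP; rewrite mulf_eq0 => /orP[/eqP //|/eqP r1j].
  by case/eqP: Tj; apply: T0r; left.
have /row_freeP[R TR] := freeT.
pose H1 := H *m invmx O *m Q.
have H1t : H1^T = Q^T *m invmx O^T *m H^T by rewrite !trmx_mul trmx_inv mulmxA.
have PH1 : G *m P *m H1^T = 1%:M.
  by rewrite H1t !mulmxA -(mulmxA G) PQO mulmxK ?unitmx_tr.
have TH1 : T *m H1^T = 0 by rewrite H1t !mulmxA TQ !mul0mx.
pose N := 1%:M - H1^T *m (G *m P).
have NQ : N *m Q^T = 0.
  rewrite mulmxBl mul1mx H1t -!mulmxA PQO (mulmxA H^T) HG mul1mx.
  by rewrite mulVmx ?unitmx_tr // mulmx1 subrr.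
have NT : N *m R *m (sel *m T) = N.
  have /submxP[y ->] : (N <= sel *m T)%MS.
    by apply: submx_trans (subT _ _ NQ) _; rewrite -{1}selTT submxMl.
  by rewrite -(mulmxA y) TR mulmx1.
exists (k' + c)%N, (col_mx (G *m P) (sel *m T)), (col_mx H1 (N *m R)^T), h.
exists (row_mx a 0), (row_mx b 0), (fun _ => block_mx d1 sel^T 0 0); split.
- split; rewrite tr_col_mx trmxK.
    rewrite mul_col_row PH1 -(mulmxA sel T H1^T) TH1 mulmx0.
    have -> : G *m P *m (N *m R) = 0.
      by rewrite mulmxA mulmxBr mulmx1 (mulmxA _ H1^T) PH1 mul1mx subrr mul0mx.
    have -> : sel *m T *m (N *m R) = 1%:M.
      by rewrite mulmxA mulmxBr mulmx1 (mulmxA _ H1^T) -(mulmxA sel T H1^T) TH1 mulmx0 mul0mx subr0.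
    by rewrite -scalar_mx_block.
  by rewrite mul_row_col NT addrC subrK.
- split=> i j; case: (split_ordP j) => j' ->; rewrite ?row_mxEl ?row_mxEr ?(sa, sb) //;
    exact: sign_mx0.
- rewrite !mul_row_col !mul0mx !addr0.
  have -> : b *m H1 = a *m G *m Q by rewrite !mulmxA bH mulmxK.
  apply/eqmxP/andP; split; apply/sub_row_mxP.
    by exists D; rewrite (mulmxA a) (mulmxA D _ P) (mulmxA D _ Q) -D1 !mul1mx.
  by exists (a *m G); rewrite mulmxA.
move=> _; split=> //.
  move=> i j; case: (split_ordP i) => i' ->; case: (split_ordP j) => j' ->;
    rewrite ?(block_mxEul, block_mxEur, block_mxEdl, block_mxEdr) //; exact: sign_mx0.
rewrite mul_block_col !mul0mx addr0 selTT mulmxA.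
apply: eqmx_trans eqW _; apply/eqmxP.
by rewrite col_mx_sub submx_refl sub0mx andbT -addsmxE addsmxSl.
Qed.

Theorem standardizable_subspace k l n (P Q : 'M[F]_(k, n)) (W : 'M[F]_(l, n)) :
  2%:R != 0 :> F -> isotropic_pair P Q -> standardizable false P Q (fun _ : unit => W).
Proof.
move=> two; elim/ltn_ind: n => n IHn in k P Q W *.
move=> PQ.
(* It is enough to treat a parametrization of U by a basis. *)
suff main k' (P' Q' : 'M_(k', n)) : row_free (row_mx P' Q') ->
    isotropic_pair P' Q' -> standardizable false P' Q' (fun _ : unit => W).
  pose U := row_base (row_mx P Q).
  have eqU : (row_mx P Q :=: row_mx (lsubmx U) (rsubmx U))%MS.
    by rewrite hsubmxK; apply: eqmx_sym; apply: eq_row_base.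
  apply: (@standardizable_eqmx _ _ _ _ _ _ _ _ _ _ _ _ (fun=> W) (fun=> W) eqU) => //.
  apply: main; first by rewrite hsubmxK row_base_free.
  by apply: isotropic_pair_sub PQ; rewrite eqU.
move=> freeU {}PQ; clear P Q; rename k' into m, P' into P, Q' into Q.
have reduce : reducible false P Q (fun _ : unit => W) -> standardizable false P Q (fun _ : unit => W).
  move=> [r [X [Y [ltr _ PQ2 redW]]]]; exact: redW (IHn _ ltr _ _ _ _ PQ2).
have chW := chain_const W.
have [KPQ|/kermx_mul_neq0[u uP uQ]] := eqVneq (kermx P *m Q) 0; last first.
  exact/reduce/(reducible_right PQ chW uP uQ).
have [KQP|/kermx_mul_neq0[u uQ uP]] := eqVneq (kermx Q *m P) 0; last first.
  exact/reduce/(reducible_left PQ chW uP uQ).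
have ker0 p (V : 'M_(p, m)) : V *m P = 0 -> V *m Q = 0 -> V = 0.
  move=> VP VQ; have /row_freeP[R UR] := freeU.
  by rewrite -[V]mulmx1 -UR mulmxA mul_mx_row VP VQ row_mx0 mul0mx.
have freeP : row_free P.
  by rewrite -kermx_eq0; apply/eqP/ker0 => //; apply: mulmx_ker.
have freeQ : row_free Q.
  by rewrite -kermx_eq0; apply/eqP/ker0 => //; apply: mulmx_ker.
have [radO|/rowV0Pn[u]] := eqVneq (kermx (P *m Q^T)) 0; last first.
  rewrite sub_kermx mulmxA => /eqP uPQ nzu.
  exact/reduce/(reducible_radical W two PQ freeP freeQ nzu uPQ).
have unitO : Q *m P^T \in unitmx.
  rewrite -unitmx_tr trmx_mul trmxK -row_free_unit -kermx_eq0.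
  exact/eqP.
have [CWP|/rowV0Pn[c]] := eqVneq (kermx Q^T :&: W)%MS 0; last first.
  rewrite sub_capmx sub_kermx => /andP[/eqP cQ cW] nzc.
  have [|psi c1 Ppsi] := @functional_off _ _ _ c P.
    apply: contra nzc => /submxP[v cv]; move: cQ; rewrite cv -mulmxA => /sub_kermxP.
    by rewrite radO submx0 => /eqP->; rewrite mul0mx.
  apply/reduce/(reducible_free PQ c1 Ppsi); last by move=> _; left.
  by rewrite -[Q]trmxK -trmx_mul cQ trmx0.
have [CPW|] := boolP (kermx Q^T <= P + W)%MS; last first.
  case/row_subPn=> i ci; have [|psi c1 ] := @functional_off _ _ _ (row i (kermx Q^T)) (col_mx P W).
    by rewrite -addsmxE.
  rewrite mul_col_mx -[0]col_mx0 => /eq_col_mx[Ppsi Wpsi].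
  apply/reduce/(reducible_free PQ c1 Ppsi); last by move=> _; right.
  by rewrite -[X in X *m _]trmxK -trmx_mul -row_mul mulmx_ker row0 trmx0.
apply: standardizable_symplectic => // c cQ; last first.
  by apply: submx_trans CPW; rewrite sub_kermx cQ.
by move=> cW; apply/eqP; rewrite -submx0 -CWP sub_capmx cW sub_kermx cQ eqxx.
Qed.
End Symplectic.

(** * From adapted bases to orbits *)

Local Open Scope classical_set_scope.

Lemma finite_image_data (T V : Type) (D : finType) (A : set T) (f : T -> V)
    (fits : T -> D -> Prop) :
    (forall x, A x -> exists d, fits x d) ->
    (forall x y d, A x -> A y -> fits x d -> fits y d -> f x = f y) ->
  finite_set [set f x | x in A].
Proof.
move=> ex_fit fit_inj.
pose Fd (d : D) := [set f x | x in [set x | A x /\ fits x d]].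
apply: (@sub_finite_set _ _ (\bigcup_(d in [set: D]) Fd d)).
  by move=> _ [x Ax <-]; have [d xd] := ex_fit x Ax; exists d => //; exists x.
apply: bigcup_finite => [|d _]; first exact: finite_finset.
have [[x [Ax xd]]|none] := pselect (exists x, A x /\ fits x d).
  apply: sub_finite_set (finite_set1 (f x)) => _ [y [Ay yd] <-].
  exact: fit_inj Ay Ax yd xd.
apply: sub_finite_set (finite_set0 _) => _ [y Ay <-].
by case: none; exists y.
Qed.

Section Groups.
Context {F : fieldType} {m : nat}.

Record matrix_group (A : set 'M[F]_m) : Prop := MatrixGroup {
  group_unit : forall g, A g -> g \in unitmx;
  group_mul : forall g h, A g -> A h -> A (g *m h);
  group_inv : forall g, A g -> A (invmx g) }.

Lemma stablemx_inv p (V : 'M[F]_(p, m)) (g : 'M_m) :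
  g \in unitmx -> stablemx V g -> stablemx V (invmx g).
Proof.
move=> gU Vg; have : (V <= V *m g)%MS.
  by rewrite -(mxrank_leqif_sup Vg).2 mxrankMfree // row_free_unit.
by move/(submxMr (invmx g)); rewrite mulmxK.
Qed.

Lemma matrix_group_stabilizer (H : set 'M[F]_m) I U :
  matrix_group H -> matrix_group (stabilizer H I U).
Proof.
move=> [Hu Hm Hv]; split=> [g [/Hu] //|g h [Hg Ug] [Hh Uh]|g [Hg Ug]].
  by split; [apply: Hm | move=> i Ii; apply: stablemxM; [apply: Ug | apply: Uh]].
split; first exact: Hv.
by move=> i Ii; apply: stablemx_inv; [apply: Hu | apply: Ug].
Qed.

Lemma ltranslateM k1 k2 (A : set 'M[F]_m) :
  ltranslate k1 (ltranslate k2 A) = ltranslate (k1 *m k2) A.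
Proof.
apply/seteqP; split=> [_ [_ [h Ah <-] <-]|_ [h Ah <-]].
  by exists h; rewrite // mulmxA.
by exists (k2 *m h); [exists h | rewrite mulmxA].
Qed.

Lemma ltranslate_coset (A : set 'M[F]_m) (x k1 k2 : 'M_m) :
    matrix_group A -> k2 \in unitmx -> A (invmx k2 *m (x *m k1)) ->
  ltranslate x (ltranslate k1 A) = ltranslate k2 A.
Proof.
move=> [Au Am Av] k2U; set q := invmx k2 *m _ => Aq.
have xq : x *m k1 = k2 *m q by rewrite mulKVmx.
rewrite ltranslateM xq; apply/seteqP; split=> _ [h Ah <-].
  by exists (q *m h); [apply: Am | rewrite mulmxA].
by exists (invmx q *m h); [apply/Am/Ah/Av | rewrite mulmxA mulmxK // Au].
Qed.

Lemma diag_orbit_act (K : set 'M[F]_m) x k :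
  matrix_group K -> K k -> diag_orbit K (diag_act k x) = diag_orbit K x.
Proof.
move=> [Ku Km Kv] Kk.
have act_mul k1 k2 (y : set 'M[F]_m * set 'M[F]_m) :
    diag_act k1 (diag_act k2 y) = diag_act (k1 *m k2) y.
  by rewrite /diag_act /= !ltranslateM.
apply/seteqP; split=> [_ [h Kh <-]|_ [h Kh <-]].
  by rewrite act_mul; exists (h *m k) => //; apply: Km.
exists (h *m invmx k); first exact/Km/Kv.
by rewrite act_mul mulmxKV // Ku.
Qed.

End Groups.

Section SignData.
Context {F : fieldType}.

Definition sign_of (t : 'I_3) : F := nth 0 [:: 0; 1; -1] t.

Lemma sign_mxP p q (A : 'M[F]_(p, q)) :
  sign_mx A -> exists A' : 'M['I_3]_(p, q), A = map_mx sign_of A'.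
Proof.
move=> sA; exists (\matrix_(i, j) inord (index (A i j) [:: 0; 1; -1])).
apply/matrixP => i j; rewrite !mxE /sign_of inordK ?nth_index //.
by have := sA i j; rewrite -index_mem.
Qed.

(** The set of rows determines the row space and, unlike the matrix, ranges over a
finite type that does not depend on the number of rows. *)
Definition row_data p q (A : 'M['I_3]_(p, q)) : {ffun 'rV['I_3]_q -> bool} :=
  [ffun v => [exists i, v == row i A]].

Lemma row_data_eqmx p p' q (A : 'M['I_3]_(p, q)) (A' : 'M['I_3]_(p', q)) :
  row_data A = row_data A' -> (map_mx sign_of A :=: map_mx sign_of A')%MS.
Proof.
have sub r r' (X : 'M_(r, q)) (Y : 'M_(r', q)) :
    row_data X = row_data Y -> (map_mx sign_of X <= map_mx sign_of Y)%MS.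
  move=> /ffunP eqXY; apply/row_subP => i.
  have : row_data X (row i X) by rewrite ffunE; apply/existsP; exists i.
  rewrite eqXY ffunE => /existsP[j /eqP eq_row].
  by rewrite -map_row eq_row map_row row_sub.
by move=> eqA; apply/eqmxP; rewrite !sub.
Qed.

End SignData.

Lemma basis_of_rank (F : fieldType) p m r (A : 'M[F]_(p, m)) :
  \rank A = r -> exists E : 'M_(r, m), (E :=: A)%MS.
Proof. by move=> <-; exists (row_base A); apply: eq_row_base. Qed.

Lemma right_inverse_square (F : fieldType) p q (A : 'M[F]_(p, q)) (A' : 'M_(q, p)) :
  p = q -> A *m A' = 1%:M -> A' *m A = 1%:M.
Proof. by move=> eq_pq; subst p; apply: mulmx1C. Qed.

Lemma det_conj_rect (F : fieldType) p q (A : 'M[F]_(p, q)) (A' : 'M_(q, p)) (D : 'M_p) :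
  p = q -> A *m A' = 1%:M -> \det (A' *m D *m A) = \det D.
Proof.
move=> eq_pq; subst p => AA'.
by rewrite !det_mulmx mulrAC -det_mulmx (mulmx1C AA') det1 mul1r.
Qed.

Section Frame.
Context {F : fieldType} {n : nat} {B Vp Vm : 'M[F]_(2 * n)}.
Context (B_sym : B^T = B) (B_nondeg : B \in unitmx).

Lemma special_orthogonal_group : matrix_group (special_orthogonal B).
Proof.
have unit g : special_orthogonal B g -> g \in unitmx.
  by case=> _ det_g; rewrite unitmxE det_g unitr1.
split=> // [g h [gB dg] [hB dh]|g Gg].
  split; last by rewrite det_mulmx dg dh mulr1.
  by rewrite trmx_mul !mulmxA -(mulmxA g h) -(mulmxA g) hB gB.
have gU := unit g Gg; case: Gg => gB dg; split; last by rewrite det_inv dg invr1.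
rewrite -{1}gB trmx_inv !mulmxA mulVmx // mul1mx -mulmxA mulmxV ?mulmx1 //.
by rewrite unitmx_tr.
Qed.

Lemma levi_GL_group : matrix_group (levi_GL B Vp Vm).
Proof.
have [Gu Gm Gv] := special_orthogonal_group.
split=> [g [/Gu] //|g h [Gg gp gm] [Gh hp hm]|g [Gg gp gm]].
  by split; [apply: Gm | apply: stablemxM | apply: stablemxM].
by split; [apply: Gv | apply: stablemx_inv => //; apply: Gu ..].
Qed.

(** As B is nondegenerate, it puts Vp and Vm in duality; a basis of Vp and the dual
basis of Vm make up a basis in which B is hyperbolic. *)
Lemma hyperbolic_frame : lagrangian_decomposition B Vp Vm ->
  exists Ep Em : 'M[F]_(n, 2 * n),
    [/\ (Ep :=: Vp)%MS, (Em :=: Vm)%MS, Ep *m B *m Ep^T = 0,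
        Em *m B *m Em^T = 0 & Ep *m B *m Em^T = 1%:M].
Proof.
case=> [[isop rkp] [isom rkm] sumV _].
have [Ep eqp] := basis_of_rank rkp; have [E eqm] := basis_of_rank rkm.
have iso p (A : 'M_(p, 2 * n)) V : (A <= V)%MS -> isotropic B V -> A *m B *m A^T = 0.
  move=> /submxP[D ->] VB; rewrite trmx_mul !mulmxA -!(mulmxA D) VB.
  by rewrite mul0mx mulmx0.
have isoEp : Ep *m B *m Ep^T = 0 by apply: iso isop; rewrite eqp.
have isoE : E *m B *m E^T = 0 by apply: iso isom; rewrite eqm.
have freeEp : row_free Ep by rewrite /row_free eqp rkp.
pose D := Ep *m B *m E^T.
have unitD : D \in unitmx.
  rewrite -row_free_unit -kermx_eq0; apply/eqP; set N := kermx D.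
  have ND : N *m Ep *m B *m E^T = 0 by rewrite -!(mulmxA N); apply: mulmx_ker.
  have NE : N *m Ep *m B *m Ep^T = 0 by rewrite -!(mulmxA N) isoEp mulmx0.
  have /submxP[S def1] : ((1%:M : 'M_(2 * n)) <= col_mx Ep E)%MS.
    by rewrite -addsmxE (adds_eqmx eqp eqm) sumV.
  have NB : N *m Ep *m B = 0.
    rewrite -[LHS]mulmx1 -[1%:M]trmx1 def1 trmx_mul tr_col_mx mulmxA mul_mx_row.
    by rewrite ND NE row_mx0 mul0mx.
  have NEp : N *m Ep = 0 by rewrite -[LHS](mulmxK B_nondeg) NB mul0mx.
  by have /row_freeP[R ER] := freeEp; rewrite -[N]mulmx1 -ER mulmxA NEp mul0mx.
exists Ep, ((invmx D)^T *m E); split=> //.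
- apply: eqmx_trans eqm; apply: eqmxMfull.
  by rewrite row_full_unit unitmx_tr unitmx_inv.
- by rewrite trmx_mul trmxK !mulmxA -!(mulmxA (invmx D)^T) isoE mul0mx mulmx0.
by rewrite trmx_mul trmxK mulmxA mulmxV.
Qed.
End Frame.

(** The coset of g in G / P corresponds to the isotropic subspace U_s g^-1, and that of
k in K / Q to the flag of the W_j k^-1. Mapping the frame Ep, Em to an adapted
basis of Vp and its dual basis is an element h of K. If two double flags
have the same coordinates in adapted bases given by h1 and h2, then h2^-1 h1
maps the first to the second. *)
Lemma finitely_many_orbits_standardizable (F : fieldType) (n : nat)
    (B Vp Vm : 'M[F]_(2 * n)) (coord : bool) (I : finType) (s : nat) (T : set nat)
    (U W : nat -> 'M[F]_(2 * n)) (Wf : I -> 'M[F]_(2 * n)) :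
    B^T = B -> B \in unitmx -> lagrangian_decomposition B Vp Vm ->
    isotropic B (U s) -> (forall i, Wf i <= Vp)%MS ->
    (forall j, T j -> exists i, Wf i = W j) ->
    (forall (P Q C : 'M[F]_(2 * n, n)), isotropic_pair P Q ->
       \rank (row_mx P Q) = \rank (U s) ->
       standardizable coord P Q (fun i => Wf i *m C)) ->
  finitely_many_orbits (levi_GL B Vp Vm) (stabilizer (levi_GL B Vp Vm) T W)
    (special_orthogonal B) (stabilizer (special_orthogonal B) [set s] U).
Proof.
move=> B_sym B_nondeg Vpm isoU Wf_Vp covT std.
set K := levi_GL B Vp Vm; set G := special_orthogonal B.
set Q := stabilizer K T W; set P := stabilizer G [set s] U.
have grG : matrix_group G := special_orthogonal_group.
have grK : matrix_group K := levi_GL_group.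
have grQ : matrix_group Q := matrix_group_stabilizer T W grK.
have grP : matrix_group P := matrix_group_stabilizer [set s] U grG.
have KG k : K k -> G k by case.
have [Ep [Em [eqp eqm isoEp isoEm EpEm]]] := hyperbolic_frame B_nondeg Vpm.
have EmEp : Em *m B *m Ep^T = 1%:M.
  by have := congr1 trmx EpEm; rewrite !trmx_mul trmxK B_sym trmx1 mulmxA.
pose M := col_mx Ep Em; pose J : 'M[F]_(n + n) := block_mx 0 1%:M 1%:M 0.
have MBM : M *m B *m M^T = J.
  by rewrite /M mul_col_mx tr_col_mx mul_col_row isoEp isoEm EpEm EmEp.
have JJ : J *m J = 1%:M.
  by rewrite mulmx_block !mul0mx !mulmx0 !mulmx1 !addr0 !add0r -scalar_mx_block.
pose Mi := B *m M^T *m J.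
have MMi : M *m Mi = 1%:M by rewrite /Mi !mulmxA MBM JJ.
have eq_nn : (n + n = 2 * n)%N by rewrite mul2n addnn.
have MiM : Mi *m M = 1%:M := right_inverse_square eq_nn MMi.
have MpM p (A D : 'M[F]_(p, n)) : row_mx A D *m M = A *m Ep + D *m Em by rewrite mul_row_col.
have EpMi : Ep *m Mi = row_mx 1%:M 0 /\ Em *m Mi = row_mx 0 1%:M.
  by move: MMi; rewrite /M mul_col_mx scalar_mx_block block_mxEv => /eq_col_mx.
clearbody Mi.
have BJ : B = Mi *m J *m Mi^T.
  rewrite -MBM !mulmxA MiM mul1mx -mulmxA -trmx_mul MiM trmx1 mulmx1 //.
pose fits (x : set 'M[F]_(2 * n) * set 'M[F]_(2 * n))
    (d : {ffun 'rV['I_3]_(n + n) -> bool} * {ffun I -> 'M['I_3]_n}) : Prop :=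
  exists k g h p (ab : 'M['I_3]_(p, n + n)),
    [/\ K k /\ G g, x = (ltranslate k Q, ltranslate g P), K h,
        d.1 = row_data ab /\ (U s *m invmx g :=: map_mx sign_of ab *m M *m h)%MS &
        forall i, (Wf i *m invmx k :=: map_mx sign_of (d.2 i) *m Ep *m h)%MS].
have transport p (V : 'M[F]_(p, 2 * n)) q q' (N : 'M[F]_(q, 2 * n))
    (N' : 'M[F]_(q', 2 * n)) g1 g2 h1 h2 :
    (V *m invmx g1 :=: N *m h1)%MS -> (V *m invmx g2 :=: N' *m h2)%MS ->
    (N :=: N')%MS -> G g1 -> G h2 -> stablemx V (invmx g2 *m (invmx h2 *m h1 *m g1)).
  move=> eq1 eq2 eqN /(group_unit grG) g1U /(group_unit grG) h2U.
  rewrite !mulmxA.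
  apply: (@submx_trans _ _ _ _ _ _ (N' *m h2 *m invmx h2 *m h1 *m g1)).
    by do !apply: submxMr; rewrite eq2.
  rewrite mulmxK //; apply: (@submx_trans _ _ _ _ _ _ (N *m h1 *m g1)).
    by do !apply: submxMr; rewrite eqN.
  apply: (@submx_trans _ _ _ _ _ _ (V *m invmx g1 *m g1)).
    by apply: submxMr; rewrite eq1.
  by rewrite mulmxKV.
apply: (@finite_image_data _ _ _ _ _ fits).
  move=> [x1 x2] [/= [k Kk <-] [g Gg <-]].
  pose Ml := lsubmx Mi; pose Mr := rsubmx Mi; pose U' := U s *m invmx g.
  pose P' := U' *m Ml; pose Q' := U' *m Mr.
  have PQ' : row_mx P' Q' = U' *m Mi by rewrite -mul_mx_row hsubmxK.
  have [gB _] : G (invmx g) := group_inv grG Gg.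
  have isoPQ : isotropic_pair P' Q'.
    have : U' *m B *m U'^T = 0.
      by rewrite trmx_mul !mulmxA -!(mulmxA (U s)) gB mulmxA.
    rewrite BJ !mulmxA -PQ' -mulmxA -trmx_mul -PQ' mul_row_block tr_row_mx mul_row_col.
    by rewrite !mulmx0 !mulmx1 add0r addr0 addrC.
  have rkPQ : \rank (row_mx P' Q') = \rank (U s).
    have freeMi : row_free Mi by apply/row_freeP; exists M.
    rewrite PQ' (mxrankMfree _ freeMi) mxrankMfree //.
    by rewrite row_free_unit unitmx_inv (group_unit grG).
  have [n' [Gm [Hm [p [a [b [w [[GH HG] [sa sb] eqU Ww]]]]]]]] :=
    std P' Q' (invmx k *m Ml) isoPQ rkPQ.
  have n'n : n' = n by apply/eqP; rewrite eqn_leq (mulmx1_min GH) (mulmx1_min HG).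
  subst n'.
  pose h := Mi *m block_mx Gm 0 0 Hm *m M.
  have MiMl : Ep *m Ml = 1%:M.
    by rewrite mulmx_lsub EpMi.1 row_mxKl.
  have Eph : Ep *m h = Gm *m Ep.
    by rewrite /h !mulmxA EpMi.1 mul_row_block !mul0mx !mul1mx !addr0 MpM mul0mx addr0.
  have Emh : Em *m h = Hm *m Em.
    by rewrite /h !mulmxA EpMi.2 mul_row_block !mul0mx !mul1mx !add0r MpM mul0mx add0r.
  have HGt : Hm *m Gm^T = 1%:M by rewrite -[LHS]trmxK trmx_mul trmxK GH trmx1.
  have Kh : K h.
    split.
    - split.
        have -> : h *m B *m h^T = Mi *m block_mx Gm 0 0 Hm *m (M *m B *m M^T) *m
                                  (block_mx Gm 0 0 Hm)^T *m Mi^T.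
          by rewrite /h !trmx_mul !mulmxA.
        rewrite MBM tr_block_mx -!(mulmxA Mi) !mulmx_block !trmx0.
        by rewrite !(mul0mx, mulmx0, addr0, add0r, mulmx1) GH HGt mulmxA -BJ.
      rewrite /h det_conj_rect // det_ublock -[\det Hm]det_tr -det_mulmx GH.
      exact: det1.
    - by rewrite -(eqmxMr h eqp) -eqp Eph submxMl.
    - by rewrite -(eqmxMr h eqm) -eqm Emh submxMl.
  have [a' def_a] := sign_mxP sa; have [b' def_b] := sign_mxP sb.
  have /choice[w' def_w] : forall i, exists w' : 'M['I_3]_n, w i = map_mx sign_of w'.
    by move=> i; have [swi _ _] := Ww i; apply: sign_mxP.
  exists (row_data (row_mx a' b'), [ffun i => w' i]); exists k, g, h, p, (row_mx a' b').
  split=> //= [|i].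
    split=> //; rewrite map_row_mx -def_a -def_b -mulmxA /h !mulmxA.
    rewrite -(mulmxA _ M) MMi mulmx1 mul_row_block !mulmx0 add0r addr0.
    by rewrite -[U s *m _]mulmx1 -MiM mulmxA -/U' -PQ'; apply: eqmxMr.
  rewrite ffunE -def_w -mulmxA Eph mulmxA; have [_ _ eqWi] := Ww i.
  have -> : Wf i *m invmx k = Wf i *m (invmx k *m Ml) *m Ep; last exact: eqmxMr.
  have /submxP[c def_c] : (Wf i *m invmx k <= Ep)%MS.
    rewrite eqp; apply: (submx_trans (submxMr _ (Wf_Vp i))).
    by have [_ ? _] := group_inv grK Kk.
  by rewrite mulmxA def_c -(mulmxA c) MiMl mulmx1.
move=> x y d _ _ [k1 [g1 [h1 [p1 [ab1 [[Kk1 Gg1] -> Kh1 [d1 eqU1] eqW1]]]]]].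
move=> [k2 [g2 [h2 [p2 [ab2 [[Kk2 Gg2] -> Kh2 [d2 eqU2] eqW2]]]]]].
pose kap := invmx h2 *m h1.
have Kkap : K kap by apply: (group_mul grK) => //; apply: (group_inv grK).
rewrite -(diag_orbit_act _ grK Kkap); congr (diag_orbit K _).
rewrite /diag_act /=; congr pair; apply: ltranslate_coset => //.
- exact: group_unit grK _ Kk2.
- split; first by do ![apply: (group_mul grK) | apply: (group_inv grK)].
  move=> j Tj; have [i <-] := covT j Tj.
  by apply: (transport _ _ _ _ _ _ _ _ _ _ (eqW1 i) (eqW2 i)) => //; apply: KG.
- exact: group_unit grG _ Gg2.
split; first by do ![apply: (group_mul grG) | apply: (group_inv grG)] => //; apply: KG.
move=> _ ->; apply: (transport _ _ _ _ _ _ _ _ _ _ eqU1 eqU2) => //; last exact: KG.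
by apply: eqmxMr; apply: row_data_eqmx; rewrite -d1 -d2.
Qed.

(** U is contained in its orthogonal, and both have dimension n. *)
Lemma maximal_isotropic_rank (F : fieldType) k n (P Q : 'M[F]_(k, n)) :
  isotropic_pair P Q -> \rank (row_mx P Q) = n -> maximal_isotropic P Q.
Proof.
move=> PQ rkU x y xy; pose J : 'M[F]_(n + n) := block_mx 0 1%:M 1%:M 0.
have JJ : J *m J = 1%:M.
  by rewrite mulmx_block !mul0mx !mulmx0 !mulmx1 !addr0 !add0r -scalar_mx_block.
have unitJ : J \in unitmx by case/mulmx1_unit: JJ.
pose U := row_mx P Q; pose N := kermx (J *m U^T).
have pairJ p (a b : 'M_(p, n)) : row_mx a b *m (J *m U^T) = b *m P^T + a *m Q^T.
  rewrite mulmxA mul_row_block !mulmx0 !mulmx1 add0r addr0 /U tr_row_mx.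
  by rewrite mul_row_col.
have UN : (U <= N)%MS by rewrite sub_kermx pairJ addrC PQ.
have rkN : \rank N = n.
  rewrite mxrank_ker -mxrank_tr trmx_mul trmxK mxrankMfree.
    by rewrite /U rkU addnK.
  by rewrite row_free_unit unitmx_tr.
have NU : (N <= U)%MS by rewrite -(mxrank_leqif_sup UN).2 rkN rkU.
apply: submx_trans NU.
rewrite sub_kermx pairJ -trmx_eq0 linearD /= !trmx_mul !trmxK.
by rewrite xy.
Qed.

Lemma standardizable_rank1 (F : fieldType) k l n (I : finType) (P Q : 'M[F]_(k, n))
    (W : I -> 'M[F]_(l, n)) :
    2%:R != 0 :> F -> isotropic_pair P Q -> \rank (row_mx P Q) = 1%N -> chain W ->
  standardizable true P Q W.
Proof.
move=> two PQ rkU chW; have [v eqv] := basis_of_rank rkU.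
have eqU : (row_mx P Q :=: row_mx (lsubmx v) (rsubmx v))%MS.
  by rewrite hsubmxK; apply: eqmx_sym.
apply: (@standardizable_eqmx _ _ _ _ _ _ _ _ _ _ _ _ W W eqU) => //.
by apply: standardizable_line => //; apply: isotropic_pair_sub PQ; rewrite eqU.
Qed.

Unset Implicit Arguments.

Theorem mainTheorem13 (R : realType) (n : nat)
    (B Vp Vm : 'M[R[i]]_(2 * n))
    (B_sym : B^T = B) (B_nondeg : B \in unitmx)
    (Vpm : lagrangian_decomposition B Vp Vm)
    (S T : set nat)
    (S_sub : forall i, S i -> (1 <= i <= n)%N)
    (T_sub : forall j, T j -> (1 <= j <= n.-1)%N)
    (U W : nat -> 'M[R[i]]_(2 * n))
    (U_flag : isotropic_flag B Vp S U) (W_flag : linear_flag Vp T W) :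
  let G := special_orthogonal B in
  let K := levi_GL B Vp Vm in
  let P := stabilizer G S U in
  let Q := stabilizer K T W in
  (S = [set 1%N] \/ S = [set n.-1] \/ S = [set n] ->
     finitely_many_orbits K Q G P) /\
  (forall i j : nat, S = [set i] -> T = [set j] ->
     finitely_many_orbits K Q G P).
Proof.
move=> G K P Q.
have two : 2%:R != 0 :> R[i] by rewrite pnatr_eq0.
have [isoU _ lag_n1 lag_n _] := U_flag; have [WVp chW] := W_flag.
have lag s : S s -> s = n.-1 \/ s = n -> lagrangian B (U s).
  by move=> Ss [eq_s|eq_s]; rewrite eq_s in Ss *; [case: (lag_n1 Ss) | case: (lag_n Ss)].
have dims s : S s -> (s + 2 <= n)%N \/ (s = n.-1 \/ s = n).
  move=> /S_sub/andP[s_gt0 s_le]; case: (leqP (s + 2) n) => [|ltn]; first by left.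
  right; case: (ltngtP s n) s_le => // [s_lt|->] _; [left | by right].
  apply/eqP; rewrite eqn_leq; case: (n) ltn s_lt => // n' ltn s_lt.
  by rewrite -ltnS s_lt /=; move: ltn; rewrite addn2 !ltnS.
split; last first.
  move=> i j eqS eqT; have Si : S i by rewrite eqS.
  have Tj : T j by rewrite eqT.
  have iso : isotropic B (U i).
    by have [/isoU[] //|/lag[]] := dims i Si.
  rewrite /P eqS.
  apply: (@finitely_many_orbits_standardizable _ _ _ _ _ false unit i T U W (fun=> W j)) => //.
  - by move=> _; have [] := WVp j Tj.
  - by rewrite eqT => _ ->; exists tt.
  by move=> P' Q' C isoPQ _; apply: standardizable_subspace.
move=> caseS; pose Wf (i : 'I_n) := if `[< T i >] then W i else 0.
suff fin s : S = [set s] -> isotropic B (U s) /\ \rank (U s) = 1%N \/ lagrangian B (U s) ->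
    finitely_many_orbits K Q G P.
  case: caseS => [eqS|[eqS|eqS]]; apply: (fin _ eqS).
  - have S1 : S 1%N by rewrite eqS.
    by have [/isoU[] //|/lag] := dims 1%N S1; [left | right; auto].
  - by right; apply: lag; [rewrite eqS | left].
  - by right; apply: lag; [rewrite eqS | right].
move=> eqS isoUs; rewrite /P eqS.
have chWf : chain Wf.
  move=> i j; rewrite /Wf; case: asboolP => Ti; case: asboolP => Tj; rewrite ?sub0mx ?orbT //.
  case: (ltngtP i j) => [lt_ij|lt_ji|->]; rewrite ?submx_refl //.
    by rewrite chW.
  by rewrite orbC chW.
apply: (@finitely_many_orbits_standardizable _ _ _ _ _ true 'I_n s T U W Wf) => //.
- by case: isoUs => [[]|[]].
- by move=> i; rewrite /Wf; case: asboolP => [/WVp[]|_]; rewrite ?sub0mx.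
- move=> j Tj; have /andP[j_gt0 j_le] := T_sub j Tj.
  have j_lt : (j < n)%N by case: (n) j_le j_gt0 => [|n'] //=; case: (j).
  by exists (Ordinal j_lt); rewrite /Wf; case: asboolP.
move=> P' Q' C isoPQ rkPQ; have chWC : chain (fun i => Wf i *m C).
  by move=> i j; have /orP[/submxMr s1|/submxMr s1] := chWf i j; rewrite s1 ?orbT.
case: isoUs => [[_ rk1]|[_ rkn]].
  by apply: standardizable_rank1; rewrite // rkPQ.
apply: standardizable_lagrangian => //.
by apply: maximal_isotropic_rank; rewrite // rkPQ.
Qed.
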